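(* Let $\mathfrak{R}$ be an o-minimal polynomially bounded structure expanding $\overline{\mathbb{R}}$, with field of exponents $\Lambda$. Let $V \subset (\mathbb{R}_{>0})^n$ be a definable set and let $\overline{V}\subset (H(\mathfrak{R})_{>0})^n$ be its extension to the Hardy field $H(\mathfrak{R})$. Then $$\mathcal{A}_0(V) \cap \Lambda^n = \mathrm{Log}(\overline{V}).$$
   Context: Structures: $\overline{\mathbb{R}}$ denotes the ordered real field $(\mathbb{R},\le,+,\cdot)$; $\mathfrak{R}$ is a first-order structure on $\mathbb{R}$ expanding it; ''definable'' means definable by a first-order formula with parameters. $\mathfrak{R}$ is polynomially bounded if every definable $f:\mathbb{R}\to\mathbb{R}$ is ultimately bounded in absolute value by some power $x^N$. For $\mathfrak{R}$ o-minimal and polynomially bounded, every definable $f:\mathbb{R}\to\mathbb{R}$ not ultimately $0$ satisfies $\lim_{x\to+\infty}f(x)/x^r=c$ for some $r,c\in\mathbb{R}$, $c\neq0$; the set of all such $r$ is a subfield of $\mathbb{R}$, the field of exponents of $\mathfrak{R}$. Logarithmic limit set: for $V\subset(\mathbb{R}_{>0})^n$ and $t\in(0,1)$ let $\mathrm{Log}_{1/t}(x_1,\dots,x_n)=(\log_{1/t}x_1,\dots,\log_{1/t}x_n)$ and $\mathcal{A}_t(V)=\mathrm{Log}_{1/t}(V)\subset\mathbb{R}^n$. For a family $(S_t)_{t\in(0,\varepsilon)}$ of subsets of $\mathbb{R}^n$, $\lim_{t\to0}S_t$ is the set of $y\in\mathbb{R}^n$ such that $(y,0)$ lies in the closure of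 $\{(x,t): x\in S_t\}$ in $\mathbb{R}^n\times[0,\varepsilon)$. Then $\mathcal{A}_0(V)=\lim_{t\to0}\mathcal{A}_t(V)$. Hardy field: $H(\mathfrak{R})$ is the set of germs at $0^+$ of definable functions $f:\mathbb{R}_{>0}\to\mathbb{R}$. It contains $\mathbb{R}$ (constants), is a real closed field, and carries a structure in the same language such that a formula holds of germs $[f_1],\dots,[f_k]$ iff it holds in $\mathfrak{R}$ of $f_1(t),\dots,f_k(t)$ for all sufficiently small $t>0$; it is an elementary extension of $\mathfrak{R}$. It has the valuation $v$ with $v([f])=r$ where $\lim_{x\to0^+}f(x)/x^r=c\ne0$. The extension $\overline{V}$ is the set defined in $H(\mathfrak{R})$ by a formula (with real parameters) defining $V$. $\mathrm{Log}(\overline V)=\{(-v(h_1),\dots,-v(h_n)):h\in\overline V\}\subset\mathbb{R}^n$. *)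

(* Defs.v *)
From HB Require Import structures.
From mathcomp Require Import all_boot all_order all_algebra generic_quotient.
From mathcomp Require Import zify.
From mathcomp Require Import all_classical all_reals all_analysis.
Import Order.TTheory GRing.Theory Num.Theory.
Import numFieldNormedType.Exports.

Set Implicit Arguments.
Unset Strict Implicit.
Unset Printing Implicit Defensive.

Local Open Scope classical_set_scope.
Local Open Scope quotient_scope.
Local Open Scope ring_scope.

Record language := Language {
  fsym : Type; farity : fsym -> nat;
  rsym : Type; rarity : rsym -> nat }.

Record structure (L : language) (T : Type) := Structure {
  fint : forall f : fsym L, ('I_(farity f) -> T) -> T;
  rint : forall r : rsym L, ('I_(rarity r) -> T) -> Prop }.

(** Terms and formulas with parameters in [A] and free variables among
    [x_0, ..., x_(n-1)]. Under [Ex] the bound variable is [ord0] and the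
    other variables are shifted by [lift ord0]. *)
Inductive term (L : language) (A : Type) (n : nat) : Type :=
| Var of 'I_n
| Par of A
| App (f : fsym L) of 'I_(farity f) -> term L A n.

Inductive formula (L : language) (A : Type) : nat -> Type :=
| Eq (n : nat) (t u : term L A n) : formula L A n
| Rel (n : nat) (r : rsym L) (ts : 'I_(rarity r) -> term L A n) :
    formula L A n
| Not (n : nat) (p : formula L A n) : formula L A n
| And (n : nat) (p q : formula L A n) : formula L A n
| Ex (n : nat) (p : formula L A n.+1) : formula L A n.

Arguments Var {L A n} _.
Arguments Par {L A n} _.
Arguments App {L A n} f _.
Arguments Eq {L A n} _ _.
Arguments Rel {L A n} r _.
Arguments Not {L A n} _.
Arguments And {L A n} _ _.
Arguments Ex {L A n} _.

Definition env_cons (T : Type) (n : nat) (a : T) (e : 'I_n -> T) :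
    'I_n.+1 -> T :=
  fun i => oapp e a (unlift ord0 i).

(** [c] interprets the parameters in the carrier [T]. *)
Fixpoint eval (L : language) (A T : Type) (S : structure L T) (c : A -> T)
    (n : nat) (e : 'I_n -> T) (t : term L A n) : T :=
  match t with
  | Var i => e i
  | Par a => c a
  | App f ts => fint S (fun i => eval S c e (ts i))
  end.

Fixpoint sat (L : language) (A T : Type) (S : structure L T) (c : A -> T)
    (n : nat) (p : formula L A n) : ('I_n -> T) -> Prop :=
  match p in formula _ _ n return ('I_n -> T) -> Prop with
  | Eq _ t u => fun e => eval S c e t = eval S c e u
  | Rel _ r ts => fun e => rint S (fun i => eval S c e (ts i))
  | Not _ q => fun e => ~ sat S c q e
  | And _ q1 q2 => fun e => sat S c q1 e /\ sat S c q2 e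
  | Ex _ q => fun e => exists a : T, sat S c q (env_cons a e)
  end.

Inductive oring_fsym := Add | Mul.
Inductive oring_rsym := Le.

Definition oring_lang : language :=
  @Language oring_fsym (fun=> 2) oring_rsym (fun=> 2).

Definition real_field (R : realType) : structure oring_lang R :=
  @Structure oring_lang R
    (fun f => match f with
              | Add => fun x : 'I_2 -> R => x ord0 + x ord_max
              | Mul => fun x : 'I_2 -> R => x ord0 * x ord_max
              end)
    (fun _ (x : 'I_2 -> R) => x ord0 <= x ord_max).

Definition sum_lang (L1 L2 : language) : language :=
  @Language (fsym L1 + fsym L2)
    (fun f => match f with inl g => farity g | inr g => farity g end)
    (rsym L1 + rsym L2)
    (fun r => match r with inl s => rarity s | inr s => rarity s end).

Definition sum_structure (L1 L2 : language) (T : Type)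
    (S1 : structure L1 T) (S2 : structure L2 T) :
    structure (sum_lang L1 L2) T :=
  @Structure (sum_lang L1 L2) T
    (fun f => match f with
              | inl g => fun x => fint S1 (f := g) x
              | inr g => fun x => fint S2 (f := g) x
              end)
    (fun r => match r with
              | inl s => fun x => rint S1 (r := s) x
              | inr s => fun x => rint S2 (r := s) x
              end).

(** A structure expanding the ordered real field is given by the
    interpretation [E] of its symbols other than [+], [*] and [<=]. *)
Definition expansion (R : realType) (L : language) (E : structure L R) :
    structure (sum_lang oring_lang L) R :=
  sum_structure (real_field R) E.

Definition defset (R : realType) (L : language) (M : structure L R)
    (n : nat) (p : formula L R n) : set 'rV[R]_n :=
  [set x | sat M id p (x ord0)].

Definition definable (R : realType) (L : language) (M : structure L R)
    (n : nat) (V : set 'rV[R]_n) : Prop :=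
  exists p : formula L R n, V = defset M p.

Definition definable_fun (R : realType) (L : language) (M : structure L R)
    (f : R -> R) : Prop :=
  definable M [set p : 'rV[R]_2 | p ord0 ord_max = f (p ord0 ord0)].

(** Definability of the restriction of [f] to the positive reals. *)
Definition definable_fun_pos (R : realType) (L : language)
    (M : structure L R) (f : R -> R) : Prop :=
  definable M [set p : 'rV[R]_2 |
    0 < p ord0 ord0 /\ p ord0 ord_max = f (p ord0 ord0)].

(** Points are the degenerate intervals [`[a, a]]. *)
Definition o_minimal (R : realType) (L : language) (M : structure L R) : Prop :=
  forall A : set R, definable M [set x : 'rV[R]_1 | A (x ord0 ord0)] ->
    exists s : seq (interval R), A = [set x | exists2 I, I \in s & x \in I].

Definition polynomially_bounded (R : realType) (L : language)
    (M : structure L R) : Prop :=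
  forall f : R -> R, definable_fun M f ->
    exists N : nat, \forall x \near +oo, `|f x| <= x ^+ N.

Definition field_of_exponents (R : realType) (L : language)
    (M : structure L R) : set R :=
  [set r | exists f : R -> R, definable_fun M f /\
     exists2 c : R, c != 0 & f x / x `^ r @[x --> +oo] --> c].

Definition up_ren (n m : nat) (r : 'I_n -> 'I_m) : 'I_n.+1 -> 'I_m.+1 :=
  fun i => oapp (fun j => lift ord0 (r j)) ord0 (unlift ord0 i).

Fixpoint tren (L : language) (A : Type) (n m : nat) (r : 'I_n -> 'I_m)
    (t : term L A n) : term L A m :=
  match t with
  | Var i => Var (r i)
  | Par a => Par a
  | App f ts => App f (fun i => tren r (ts i))
  end.

Fixpoint ren (L : language) (A : Type) (n : nat) (p : formula L A n) :
    forall m, ('I_n -> 'I_m) -> formula L A m :=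
  match p in formula _ _ n return forall m, ('I_n -> 'I_m) -> formula L A m with
  | Eq _ t u => fun m r => Eq (tren r t) (tren r u)
  | Rel _ s ts => fun m r => Rel s (fun i => tren r (ts i))
  | Not _ q => fun m r => Not (ren q r)
  | And _ q1 q2 => fun m r => And (ren q1 r) (ren q2 r)
  | Ex _ q => fun m r => Ex (ren q (up_ren r))
  end.

Lemma eval_tren (L : language) (A T : Type) (S : structure L T) (c : A -> T)
    (n m : nat) (r : 'I_n -> 'I_m) (e : 'I_m -> T) (t : term L A n) :
  eval S c e (tren r t) = eval S c (e \o r) t.
Proof.
by elim: t => //= f ts IH; congr fint; apply/funext => i; apply: IH.
Qed.

Lemma env_cons_up (T : Type) (n m : nat) (r : 'I_n -> 'I_m) (a : T)
    (e : 'I_m -> T) :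
  env_cons a e \o up_ren r = env_cons a (e \o r).
Proof.
apply/funext => i /=; rewrite /env_cons /up_ren.
by case: (unliftP ord0 i) => [j|] _ /=; rewrite ?liftK ?unlift_none.
Qed.

Lemma sat_ren (L : language) (A T : Type) (S : structure L T) (c : A -> T)
    (n : nat) (p : formula L A n) (m : nat) (r : 'I_n -> 'I_m) (e : 'I_m -> T) :
  sat S c (ren p r) e <-> sat S c p (e \o r).
Proof.
elim: p m r e => {n} [n t u|n s ts|n q IH|n q1 IH1 q2 IH2|n q IH] m r e /=.
- by rewrite !eval_tren.
- by under eq_fun do rewrite eval_tren.
- by rewrite IH.
- by rewrite IH1 IH2.
- by split=> -[a]; [rewrite IH env_cons_up|rewrite -env_cons_up -IH]; exists a.
Qed.

Fixpoint Exn (L : language) (A : Type) (k n : nat) :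
    formula L A (k + n) -> formula L A n :=
  match k with
  | 0%N => fun p => p
  | k'.+1 => fun p => @Exn L A k' n (Ex p)
  end.

Definition env_cat (T : Type) (k n : nat) (y : 'I_k -> T) (e : 'I_n -> T) :
    'I_(k + n) -> T :=
  fun i => match fintype.split i with inl j => y j | inr j => e j end.

Lemma sat_Exn (L : language) (A T : Type) (S : structure L T) (c : A -> T)
    (k n : nat) (p : formula L A (k + n)) (e : 'I_n -> T) :
  sat S c (Exn p) e <-> exists y : 'I_k -> T, sat S c p (env_cat y e).
Proof.
elim: k p => [|k IH] p /=.
  have E0 (y : 'I_0 -> T) : env_cat y e = e.
    apply/funext => i; rewrite /env_cat; case: splitP => [[]//|j ij].
    by congr e; apply: val_inj.
  split=> [pe|[y]]; last by rewrite E0.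
  by exists (fun i : 'I_0 => match notF (ltn_ord i) with end); rewrite E0.
have ES (y : 'I_k.+1 -> T) :
    env_cat y e = env_cons (y ord0) (env_cat (y \o lift ord0) e)
      :> ('I_(k + n).+1 -> T).
  apply/funext => i; rewrite /env_cons; case: unliftP => [j ->|->] /=.
    rewrite /env_cat; case: (splitP j) => [a|a] ja; case: splitP => [b|b] /=.
    - by rewrite /bump /= ja => ab; congr y; apply: val_inj; rewrite /= -ab.
    - by rewrite /bump /= ja => ab; have := ltn_ord a; lia.
    - by rewrite /bump /= ja => ab; have := ltn_ord b; lia.
    - by rewrite /bump /= ja => ab; congr e; apply: val_inj => /=; lia.
  rewrite /env_cat; case: splitP => [a a0|//].
  by congr y; apply: val_inj; exact/esym/a0.
rewrite IH /=; split=> [[y [a pa]]|[y py]].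
  exists (env_cons a y); rewrite ES.
  suff -> : env_cons a y \o lift ord0 = y.
    by have -> : env_cons a y ord0 = a by rewrite /env_cons unlift_none.
  by apply/funext => i /=; rewrite /env_cons liftK.
by exists (y \o lift ord0), (y ord0); rewrite -ES.
Qed.

Definition env2 (T : Type) (a b : T) : 'I_2 -> T :=
  fun i => if i == ord0 then a else b.

Lemma definable_fun_posP (R : realType) (L : language) (M : structure L R)
    (f : R -> R) :
  definable_fun_pos M f <->
  exists p : formula L R 2,
    forall t y, sat M id p (env2 t y) <-> 0 < t /\ y = f t.
Proof.
have envE (x : 'rV[R]_2) : x ord0 = env2 (x ord0 ord0) (x ord0 ord_max).
  apply/funext=> i; rewrite /env2; case: eqP => [->//|/eqP i0].
  by congr (x _ _); apply/val_inj; case: i i0 => -[|[|]].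
split=> -[p defp]; exists p; first move=> t y.
  have -> : env2 t y = (\row_i env2 t y i) ord0.
    by apply/funext => i; rewrite mxE.
  by rewrite -[sat _ _ _ _]/(defset M p _) -defp /= !mxE.
by apply/seteqP; split=> x /=; rewrite /defset /= envE defp.
Qed.

Definition posf (R : realType) (L : language) (n : nat) (i : 'I_n) :
    formula (sum_lang oring_lang L) R n :=
  Not (Rel (inl Le : rsym (sum_lang oring_lang L))
         (env2 (Var i) (Par (0 : R)))).

Lemma sat_posf (R : realType) (L : language) (E : structure L R) (n : nat)
    (i : 'I_n) (e : 'I_n -> R) :
  sat (expansion E) id (posf R L i) e <-> 0 < e i.
Proof. by rewrite /posf /= /env2 /= ltNge; split => /negP. Qed.

Definition conj_seq (L : language) (A : Type) (n : nat) (I : Type)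
    (p : I -> formula L A n) (q : formula L A n) (s : seq I) : formula L A n :=
  foldr (fun i r => And (p i) r) q s.

Lemma sat_conj_seq (L : language) (A T : Type) (S : structure L T) (c : A -> T)
    (n : nat) (I : eqType) (p : I -> formula L A n) (q : formula L A n)
    (s : seq I) (e : 'I_n -> T) :
  sat S c (conj_seq p q s) e <->
  (forall i, i \in s -> sat S c (p i) e) /\ sat S c q e.
Proof.
elim: s => [|a s IH] /=; first by split=> [|[]].
rewrite IH; split=> [[pa [ps qe]]|[ps qe]].
  by split=> // i; rewrite inE => /predU1P[->//|/ps].
split; first by apply: ps; rewrite mem_head.
by split=> // i si; apply: ps; rewrite inE si orbT.
Qed.

Lemma definable_cst (R : realType) (L : language) (E : structure L R) (a : R) :
  definable_fun_pos (expansion E) (fun=> a).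
Proof.
apply/definable_fun_posP.
exists (And (posf R L ord0) (Eq (Var ord_max) (Par a))) => t y.
have posE := sat_posf E ord0 (env2 t y).
by split=> -[/posE t0 yE]; split=> //; apply/posE.
Qed.

Lemma definable_app (R : realType) (L : language) (E : structure L R)
    (F : fsym (sum_lang oring_lang L)) (f : 'I_(farity F) -> R -> R) :
  (forall i, definable_fun_pos (expansion E) (f i)) ->
  definable_fun_pos (expansion E)
    (fun t => fint (expansion E) (fun i => f i t)).
Proof.
move=> /(_ _)/definable_fun_posP/cid-/all_sig[p defp].
apply/definable_fun_posP; set k := farity F in f p defp *.
pose t0 : 'I_(k + 2) := rshift k ord0; pose z0 : 'I_(k + 2) := rshift k ord_max.
pose y0 i : 'I_(k + 2) := lshift 2 i.
exists (Exn (And (posf R L t0) (conj_seq (fun i => ren (p i) (env2 t0 (y0 i)))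
  (Eq (Var z0) (App F (fun i => Var (y0 i)))) (enum 'I_k)))) => t z.
have envt y : env_cat y (env2 t z) t0 = t by rewrite /env_cat (unsplitK (inr _)).
have envz y : env_cat y (env2 t z) z0 = z by rewrite /env_cat (unsplitK (inr _)).
have envy (y : 'I_k -> R) i : env_cat y (env2 t z) (y0 i) = y i.
  by rewrite /env_cat (unsplitK (inl _)).
have envp (y : 'I_k -> R) i : env_cat y (env2 t z) \o env2 t0 (y0 i) = env2 t (y i).
  by apply/funext=> j /=; rewrite /env2; case: eqP.
rewrite sat_Exn; split=> [[y []]|[t_gt0 zE]].
  move=> /(sat_posf E t0); rewrite envt => t_gt0.
  move=> /sat_conj_seq[py /=]; rewrite envz => ->.
  split=> //; apply: (congr1 (@fint _ _ (expansion E) F)).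
  apply/funext => i; rewrite envy.
  have := py i; rewrite mem_enum => /(_ isT)/sat_ren; rewrite envp.
  by move=> /defp[].
exists (fun i => f i t); split; first by apply/(sat_posf E t0); rewrite envt.
apply/sat_conj_seq; split=> [i _|/=].
  by apply/sat_ren; rewrite envp; apply/defp.
rewrite envz; apply: (etrans zE (congr1 (@fint _ _ (expansion E) F) _)).
by apply/funext => i; rewrite envy.
Qed.

(** A function on the positive reals is represented by any extension of it to
    the real line: its values on nonpositive reals are irrelevant. *)
Definition defun (R : realType) (L : language) (E : structure L R) : Type :=
  {f : R -> R | `[< definable_fun_pos (expansion E) f >]}.

HB.instance Definition _ (R : realType) (L : language) (E : structure L R) :=
  Choice.on (defun E).

Definition germ_eq (R : realType) (L : language) (E : structure L R)
    (f g : defun E) : bool :=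
  `[< \forall t \near 0^'+, val f t = val g t >].

Lemma germ_eq_refl (R : realType) (L : language) (E : structure L R) :
  reflexive (@germ_eq R L E).
Proof. by move=> f; apply/asboolP; near=> t. Unshelve. all: by end_near. Qed.

Lemma germ_eq_sym (R : realType) (L : language) (E : structure L R) :
  symmetric (@germ_eq R L E).
Proof.
by move=> f g; apply/asboolP/asboolP; apply: filterS => t ->.
Qed.

Lemma germ_eq_trans (R : realType) (L : language) (E : structure L R) :
  transitive (@germ_eq R L E).
Proof.
move=> g f h /asboolP fg /asboolP gh; apply/asboolP.
by apply: filterS2 fg gh => t -> ->.
Qed.

Canonical germ_equiv (R : realType) (L : language) (E : structure L R) :=
  EquivRel (@germ_eq R L E) (@germ_eq_refl R L E) (@germ_eq_sym R L E)
    (@germ_eq_trans R L E).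

Definition hardy (R : realType) (L : language) (E : structure L R) : Type :=
  {eq_quot (@germ_eq R L E)}.

Definition germ (R : realType) (L : language) (E : structure L R)
    (f : R -> R) (df : definable_fun_pos (expansion E) f) : hardy E :=
  \pi_({eq_quot (@germ_eq R L E)}) (exist _ f (asboolT df) : defun E).

Definition hrepr (R : realType) (L : language) (E : structure L R)
    (h : hardy E) : R -> R :=
  val (repr (h : {eq_quot (@germ_eq R L E)})).

Lemma definable_hrepr (R : realType) (L : language) (E : structure L R)
    (h : hardy E) : definable_fun_pos (expansion E) (hrepr h).
Proof. exact: asboolW (valP (repr (h : {eq_quot (@germ_eq R L E)}))). Qed.

Definition hcst (R : realType) (L : language) (E : structure L R) (a : R) :
    hardy E :=
  germ (definable_cst E a).

(** Symbols are interpreted through arbitrary representatives, which is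
    immaterial: changing them does not affect the values near [0^'+]. *)
Definition hardy_structure (R : realType) (L : language) (E : structure L R) :
    structure (sum_lang oring_lang L) (hardy E) :=
  @Structure (sum_lang oring_lang L) (hardy E)
    (fun F h => germ (definable_app (F := F) (fun i => definable_hrepr (h i))))
    (fun r h => \forall t \near 0^'+,
       rint (expansion E) (r := r) (fun i => hrepr (h i) t)).

(** The extension of the set [defset (expansion E) p]; under o-minimality it
    depends on that set only, and not on the formula [p] defining it. *)
Definition hardy_ext (R : realType) (L : language) (E : structure L R)
    (n : nat) (p : formula (sum_lang oring_lang L) R n) :
    set ('I_n -> hardy E) :=
  [set h | sat (hardy_structure E) (@hcst R L E) p h].

Arguments hardy_ext {R L} E {n} p _.

(** The value at the germ [0] is a default value. *)
Definition hval (R : realType) (L : language) (E : structure L R)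
    (h : hardy E) : R :=
  get [set r : R | exists2 c : R, c != 0 &
    hrepr h t / t `^ r @[t --> 0^'+] --> c].

Definition Log_base (R : realType) (n : nat) (b : R) (x : 'rV[R]_n) :
    'rV[R]_n :=
  \row_(i < n) (ln (x ord0 i) / ln b).

Definition amoeba (R : realType) (n : nat) (V : set 'rV[R]_n) (t : R) :
    set 'rV[R]_n :=
  Log_base t^-1 @` V.

(** As [(y, 0)] belongs to [R^n * [0, eps[], its being in the closure taken in
    that subspace or in [R^n * R] is the same. *)
Definition lim_family (R : realType) (n : nat) (eps : R)
    (S : R -> set 'rV[R]_n) : set 'rV[R]_n :=
  [set y | closure [set p : 'rV[R]_n * R | 0 < p.2 < eps /\ S p.2 p.1] (y, 0)].

Definition log_limit_set (R : realType) (n : nat) (V : set 'rV[R]_n) :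
    set 'rV[R]_n :=
  lim_family 1 (amoeba V).

Definition Log_hardy (R : realType) (L : language) (E : structure L R)
    (n : nat) (W : set ('I_n -> hardy E)) : set 'rV[R]_n :=
  [set \row_(i < n) - hval (h i) | h in W].

(* Main.v *)
Require Import Defs.
From mathcomp Require Import all_boot all_order all_algebra generic_quotient.
From mathcomp Require Import all_classical all_reals all_analysis.
From mathcomp Require Import ring lra.
Import Order.TTheory GRing.Theory Num.Theory.
Import numFieldNormedType.Exports.

Set Implicit Arguments.
Unset Strict Implicit.
Unset Printing Implicit Defensive.

Local Open Scope classical_set_scope.
Local Open Scope quotient_scope.
Local Open Scope ring_scope.

(** The theorem equates a topological limit of the rescaled sets with the
    valuations of points of [V] over the Hardy field, so everything takes place
    along germs at [0^'+], and two tools make these germs tractable.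

    The first is [sat_hardy]: a formula holds of germs in the Hardy field exactly
    when it holds of their values near [0^'+]. By o-minimality a definable
    condition on one real holds near [0^'+] or fails near [0^'+]
    ([near_right_dichotomy]), which settles negation; quantifiers are settled by
    definable choice ([definable_choice]), which selects a point of a nonempty
    finite union of intervals by a first-order recipe.

    The second is [power_asymptotics]: a definable [f] that is positive near
    [0^'+] satisfies [f t / t `^ r --> c] with [0 < c]. Comparing powers of [f]
    with powers of [t], the dichotomy and polynomial boundedness give [r] with
    [ln (f t) / ln t --> r]. Iterating [t |-> t * y] then forces
    [f (t * y) / f t --> y `^ r] ([ratio_cvg]), so that the power function with
    exponent [r] is itself definable near [0^'+] ([power_definable]). The quotient
    [g] of [f] by this power has order [0]. If it were unbounded, choosing
    definably a [t < x] with [1 / x <= g t] would produce a function decaying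
    faster than every power of [x] ([order0_bounded]). So [g] and its inverse are
    bounded, and by the dichotomy [g] converges.

    A point of [V] over the Hardy field is a curve in [V] whose coordinates
    behave like [c * t `^ r]; its logarithms in base [1 / t] tend to [- r], which
    gives one inclusion ([germs_in_limit]). Conversely let [y] be in the limit,
    with coordinates in the field of exponents, so that the functions
    [t `^ y_i] are definable near [0^'+]. Say that [C] controls [x] at [t] if
    [C^-1 <= x_i * t `^ y_i <= C] for all [i]. By hypothesis, for each [eps > 0]
    there are arbitrarily small [t] at which [t `^ (- eps)] controls a point of
    [V]. A definable, nearly optimal control [C t] thus has order [0], hence is
    bounded by a constant ([controlled_uniformly]), and [sat_hardy] turns the
    points controlled by this constant into germs of valuation [- y_i]. *)

(** * Definable predicates and functions *)

Section Definability.
Variables (R : realType) (L : language) (E : structure L R).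
Local Notation M := (expansion E).

(** A set of environments rather than of row vectors, so that binding a
    variable amounts to precomposing with [lift ord0]. *)
Definition defpred n (P : ('I_n -> R) -> Prop) :=
  exists p : formula (sum_lang oring_lang L) R n,
    forall e, sat M id p e <-> P e.

Definition defterm n (f : ('I_n -> R) -> R) :=
  defpred (fun e : 'I_n.+1 -> R => e ord0 = f (fun i => e (lift ord0 i))).

Definition dpred1 (P : R -> Prop) := defpred (fun e : 'I_1 -> R => P (e ord0)).

Definition dpred2 (P : R -> R -> Prop) :=
  defpred (fun e : 'I_2 -> R => P (e ord0) (e ord_max)).

Definition dfun (f : R -> R) := defterm (fun e : 'I_1 -> R => f (e ord0)).

Lemma defpred_iff n (P Q : ('I_n -> R) -> Prop) :
  (forall e, P e <-> Q e) -> defpred P -> defpred Q.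
Proof. by move=> PQ [p pP]; exists p => e; rewrite pP PQ. Qed.

Lemma env_cons0 (T : Type) n (a : T) (e : 'I_n -> T) : env_cons a e ord0 = a.
Proof. by rewrite /env_cons unlift_none. Qed.

Lemma env_consS (T : Type) n (a : T) (e : 'I_n -> T) i :
  env_cons a e (lift ord0 i) = e i.
Proof. by rewrite /env_cons liftK. Qed.

Lemma env_cons_lift (T : Type) n (a : T) (e : 'I_n -> T) :
  (fun i => env_cons a e (lift ord0 i)) = e.
Proof. by apply/funext => i; rewrite env_consS. Qed.

Lemma defpred_sat n (p : formula (sum_lang oring_lang L) R n) :
  defpred (sat M id p).
Proof. by exists p. Qed.

Lemma defpred_not n (P : ('I_n -> R) -> Prop) :
  defpred P -> defpred (fun e => ~ P e).
Proof. by move=> [p pP]; exists (Not p) => e /=; rewrite pP. Qed.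

Lemma defpred_and n (P Q : ('I_n -> R) -> Prop) :
  defpred P -> defpred Q -> defpred (fun e => P e /\ Q e).
Proof. by move=> [p pP] [q qQ]; exists (And p q) => e /=; rewrite pP qQ. Qed.

Lemma defpred_or n (P Q : ('I_n -> R) -> Prop) :
  defpred P -> defpred Q -> defpred (fun e => P e \/ Q e).
Proof.
move=> dP dQ; apply: (@defpred_iff _ (fun e => ~ (~ P e /\ ~ Q e))).
  by move=> e; rewrite -not_orP notK.
by apply/defpred_not/defpred_and; apply: defpred_not.
Qed.

Lemma defpred_imp n (P Q : ('I_n -> R) -> Prop) :
  defpred P -> defpred Q -> defpred (fun e => P e -> Q e).
Proof.
move=> dP dQ; apply: (@defpred_iff _ (fun e => ~ P e \/ Q e)).
  by move=> e; rewrite implyE.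
by apply/defpred_or => //; apply: defpred_not.
Qed.

Lemma defpred_ex n (P : R -> ('I_n -> R) -> Prop) :
  defpred (fun e : 'I_n.+1 -> R => P (e ord0) (fun i => e (lift ord0 i))) ->
  defpred (fun e => exists a, P a e).
Proof.
move=> [p pP]; exists (Ex p) => e /=.
by split=> -[a] pa; exists a; move: pa; rewrite pP env_cons0 env_cons_lift.
Qed.

Lemma defpred_all n (P : R -> ('I_n -> R) -> Prop) :
  defpred (fun e : 'I_n.+1 -> R => P (e ord0) (fun i => e (lift ord0 i))) ->
  defpred (fun e => forall a, P a e).
Proof.
move=> dP; apply: (@defpred_iff _ (fun e => ~ exists a, ~ P a e)).
  move=> e; split=> [h a|h [a]]; last by apply; apply: h.
  by apply: contrapT => nPa; apply: h; exists a.
by apply/defpred_not/defpred_ex/defpred_not.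
Qed.

Lemma defpred_exn k n (P : ('I_k -> R) -> ('I_n -> R) -> Prop) :
  defpred (fun e : 'I_(k + n) -> R =>
    P (fun i => e (lshift n i)) (fun i => e (rshift k i))) ->
  defpred (fun e => exists y, P y e).
Proof.
move=> [p pP]; exists (Exn p) => e; rewrite sat_Exn.
have envl (y : 'I_k -> R) : (fun i => env_cat y e (lshift n i)) = y.
  by apply/funext => i; rewrite /env_cat (unsplitK (inl _)).
have envr (y : 'I_k -> R) : (fun i => env_cat y e (rshift k i)) = e.
  by apply/funext => i; rewrite /env_cat (unsplitK (inr _)).
by split=> -[y] py; exists y; move: py; rewrite pP envl envr.
Qed.

Lemma defpred_forall_ord k n (P : 'I_k -> ('I_n -> R) -> Prop) :
  (forall i, defpred (P i)) -> defpred (fun e => forall i, P i e).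
Proof.
move=> /(_ _)/cid-/all_sig[p pP].
pose T : formula (sum_lang oring_lang L) R n := Eq (Par 0) (Par 0).
exists (conj_seq p T (enum 'I_k)) => e; rewrite sat_conj_seq.
split=> [[h _] i|h]; first by apply/pP/h; rewrite mem_enum.
by split=> // i _; apply/pP.
Qed.

Lemma defpred_ren n m (r : 'I_n -> 'I_m) (P : ('I_n -> R) -> Prop) :
  defpred P -> defpred (fun e => P (fun i => e (r i))).
Proof. by move=> [p pP]; exists (ren p r) => e; rewrite sat_ren pP. Qed.

Lemma defterm_ren n m (r : 'I_n -> 'I_m) (f : ('I_n -> R) -> R) :
  defterm f -> defterm (fun e => f (fun i => e (r i))).
Proof.
move=> df; have := defpred_ren (up_ren r) df; apply: defpred_iff => e.
rewrite /up_ren unlift_none /=.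
by under [X in f X]eq_fun do rewrite liftK.
Qed.

(** Composition of definable maps: the values [f i e] are existentially
    quantified as [k] further variables. *)
Lemma defpred_subst k n (P : ('I_k -> R) -> Prop) (f : 'I_k -> ('I_n -> R) -> R) :
  defpred P -> (forall i, defterm (f i)) ->
  defpred (fun e => P (fun i => f i e)).
Proof.
move=> dP df.
apply: (@defpred_iff _
  (fun e => exists y, (forall i : 'I_k, y i = f i e) /\ P y)) => [e|].
  split=> [[y [yE]]|Pe]; last by exists (fun i => f i e).
  by congr P; apply/funext.
apply/defpred_exn/defpred_and; last exact: defpred_ren.
apply: defpred_forall_ord => i.
pose r (j : 'I_n.+1) := oapp (@rshift k n) (lshift n i) (unlift ord0 j).
apply: defpred_iff (defpred_ren r (df i)) => e.
rewrite /r unlift_none /=.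
by under [X in f _ X]eq_fun do rewrite liftK.
Qed.

Lemma defterm_subst k n (g : ('I_k -> R) -> R) (f : 'I_k -> ('I_n -> R) -> R) :
  defterm g -> (forall i, defterm (f i)) -> defterm (fun e => g (fun i => f i e)).
Proof.
move=> dg df.
pose F (i : 'I_k.+1) (e : 'I_n.+1 -> R) := oapp
  (fun j => f j (fun l => e (lift ord0 l))) (e ord0) (unlift ord0 i).
apply: (@defpred_iff _ (fun e => F ord0 e =
    g (fun i => F (lift ord0 i) e))) => [e|].
  rewrite /F unlift_none /=.
  by under [X in g X]eq_fun do rewrite liftK.
apply: (@defpred_subst _ _ (fun e => e ord0 = g (fun i => e (lift ord0 i)))) => // i.
rewrite /F; case: unliftP => [j|] _ /=.
  exact: (defterm_ren (lift ord0) (df j)).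
by exists (Eq (Var ord0) (Var (lift ord0 ord0))).
Qed.

Lemma defterm_var n (i : 'I_n) : defterm (fun e => e i).
Proof. by exists (Eq (Var ord0) (Var (lift ord0 i))). Qed.

Lemma defterm_cst n (a : R) : defterm (fun _ : 'I_n -> R => a).
Proof. by exists (Eq (Var ord0) (Par a)). Qed.

Lemma defterm_add n (f g : ('I_n -> R) -> R) :
  defterm f -> defterm g -> defterm (fun e => f e + g e).
Proof.
move=> df dg.
apply: (@defterm_subst 2 _ (fun e => e ord0 + e ord_max)
  (fun i => if i == ord0 then f else g)); last by move=> i; case: ifP.
exists (Eq (Var ord0) (@App (sum_lang oring_lang L) _ _ (inl Add)
  (fun i : 'I_2 => Var (lift ord0 i)))) => e; exact: iff_refl.
Qed.

Lemma defterm_mul n (f g : ('I_n -> R) -> R) :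
  defterm f -> defterm g -> defterm (fun e => f e * g e).
Proof.
move=> df dg.
apply: (@defterm_subst 2 _ (fun e => e ord0 * e ord_max)
  (fun i => if i == ord0 then f else g)); last by move=> i; case: ifP.
exists (Eq (Var ord0) (@App (sum_lang oring_lang L) _ _ (inl Mul)
  (fun i : 'I_2 => Var (lift ord0 i)))) => e; exact: iff_refl.
Qed.

Lemma defpred2 n (P : R -> R -> Prop) (f g : ('I_n -> R) -> R) :
  dpred2 P -> defterm f -> defterm g -> defpred (fun e => P (f e) (g e)).
Proof.
move=> dP df dg; apply: (@defpred_subst 2 _ (fun e => P (e ord0) (e ord_max))
  (fun i => if i == ord0 then f else g)) => // i; by case: ifP.
Qed.

Lemma defpred1 n (P : R -> Prop) (f : ('I_n -> R) -> R) :
  dpred1 P -> defterm f -> defpred (fun e => P (f e)).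
Proof.
by move=> dP df; apply: (@defpred_subst 1 _ (fun e => P (e ord0)) (fun=> f)).
Qed.

Lemma defterm1 n (h : R -> R) (f : ('I_n -> R) -> R) :
  dfun h -> defterm f -> defterm (fun e => h (f e)).
Proof.
by move=> dP df; apply: (@defterm_subst 1 _ (fun e => h (e ord0)) (fun=> f)).
Qed.

Lemma defpred_eq n (f g : ('I_n -> R) -> R) :
  defterm f -> defterm g -> defpred (fun e => f e = g e).
Proof.
move=> df dg; apply: (defpred2 (P := @eq R)) => //.
by exists (Eq (Var ord0) (Var ord_max)).
Qed.

Lemma defpred_le n (f g : ('I_n -> R) -> R) :
  defterm f -> defterm g -> defpred (fun e => f e <= g e).
Proof.
move=> df dg; apply: (defpred2 (P := fun x y => x <= y)) => //.
exists (@Rel (sum_lang oring_lang L) _ _ (inl Le) (fun i : 'I_2 => Var i)) => e.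
exact: iff_refl.
Qed.

Lemma defpred_lt n (f g : ('I_n -> R) -> R) :
  defterm f -> defterm g -> defpred (fun e => f e < g e).
Proof.
move=> df dg; apply: (@defpred_iff _ (fun e => ~ g e <= f e)) => [e|].
  by rewrite ltNge; split=> /negP.
exact/defpred_not/defpred_le.
Qed.

Lemma defterm_graph n (f : ('I_n -> R) -> R) (P : R -> ('I_n -> R) -> Prop) :
  (forall e z, z = f e <-> P z e) ->
  defpred (fun e : 'I_n.+1 -> R => P (e ord0) (fun i => e (lift ord0 i))) ->
  defterm f.
Proof. by move=> fP; apply: defpred_iff => e; rewrite fP. Qed.

Lemma defterm_opp n (f : ('I_n -> R) -> R) :
  defterm f -> defterm (fun e => - f e).
Proof.
move=> df.
apply: (@defterm_graph _ _ (fun z e => z + f e = 0)) => [e z|].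
  by split=> [->|/eqP]; [rewrite addNr|rewrite addr_eq0 => /eqP].
apply: defpred_eq; last exact: defterm_cst.
by apply: defterm_add; [exact: defterm_var|exact: (defterm_ren (lift ord0) df)].
Qed.

Lemma defterm_inv n (f : ('I_n -> R) -> R) :
  defterm f -> defterm (fun e => (f e)^-1).
Proof.
move=> df; have df' := defterm_ren (lift ord0) df.
apply: (@defterm_graph _ _
  (fun z e => z * f e = 1 \/ f e = 0 /\ z = 0)) => [e z|].
  split=> [->|[h|[-> ->]]]; last by rewrite invr0.
    have [->|f0] := eqVneq (f e) 0; first by right; rewrite invr0.
    by left; rewrite mulVf.
  have f0 : f e != 0 by apply/eqP => f0; move: h; rewrite f0 mulr0 => /esym/eqP;
    rewrite oner_eq0.
  by apply: (mulIf f0); rewrite h mulVf.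
by apply: defpred_or; [|apply: defpred_and]; apply: defpred_eq => //;
  try exact: defterm_cst; try exact: defterm_var;
  apply: defterm_mul => //; exact: defterm_var.
Qed.

Lemma defterm_exp n (f : ('I_n -> R) -> R) k :
  defterm f -> defterm (fun e => f e ^+ k).
Proof.
move=> df; elim: k => [|k IH]; first exact: defterm_cst.
have -> : (fun e => f e ^+ k.+1) = (fun e => f e * f e ^+ k).
  by apply/funext => e; rewrite exprS.
exact: defterm_mul.
Qed.

Lemma defterm_if n (P : ('I_n -> R) -> bool) (f g : ('I_n -> R) -> R) :
  defpred P -> defterm f -> defterm g ->
  defterm (fun e => if P e then f e else g e).
Proof.
move=> dP df dg.
apply: (@defterm_graph _ _ (fun z e => P e /\ z = f e \/ ~ P e /\ z = g e)).
  move=> e z; case: ifP => Pe; split=> [|[[]|[]]] //; [by left|by right].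
have dP' := defpred_ren (lift ord0) dP.
exact: defpred_or (defpred_and dP' df) (defpred_and (defpred_not dP') dg).
Qed.

End Definability.

(** Proves definability by following the syntax of a predicate or function;
    parameters of the context are handled through their own definability. *)
Ltac definable := repeat (unfold dpred1, dpred2, dfun; cbv beta; first
  [ assumption
  | simple apply defterm_var | simple apply defterm_cst
  | simple apply defpred_not | simple apply defpred_and
  | simple apply defpred_or | simple apply defpred_ex
  | simple apply defpred_imp | simple apply defpred_all
  | simple apply defpred_le | simple apply defpred_lt
  | simple apply defpred_eq
  | simple apply defterm_add | simple apply defterm_opp
  | simple apply defterm_mul | simple apply defterm_inv
  | simple apply defterm_exp
  | match goal with
    | H : dfun _ _ |- _ => refine (@defterm1 _ _ _ _ _ _ H _)
    | H : dpred2 _ _ |- _ => refine (@defpred2 _ _ _ _ _ _ _ H _ _)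
    | H : dpred1 _ _ |- _ => refine (@defpred1 _ _ _ _ _ _ H _)
    end ]).

(** * One-sided neighbourhoods and definable choice *)

Section Choice.
Variables (R : realType) (L : language) (E : structure L R).
Hypothesis omin : o_minimal (expansion E).

Lemma near_right_not (A : R -> Prop) (m : R) :
  (\forall x \near m^'+, A x) -> ~ (\forall x \near m^'+, ~ A x).
Proof.
move=> nA nNA.
have h : \forall x \near m^'+, A x /\ ~ A x by apply: filterS2 nA nNA.
by have [x []] := @filter_ex _ _ (at_right_proper_filter m) _ h.
Qed.

Lemma near_right_ex (A : R -> Prop) (m : R) :
  (\forall x \near m^'+, A x) -> exists x, A x.
Proof. exact: (@filter_ex _ _ (at_right_proper_filter m)). Qed.

Lemma near_rightP (A : R -> Prop) (m : R) :
  (\forall x \near m^'+, A x) <-> exists2 d, m < d & forall x, m < x < d -> A x.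
Proof.
split=> [[e /= e0 h]|[d md h]].
  exists (m + e) => [|x /andP[mx xd]]; first by lra.
  by apply: h => //=; rewrite distrC gtr0_norm; lra.
near=> x; apply: h; apply/andP; split; near: x.
  exact: nbhs_right_gt.
exact: nbhs_right_lt.
Unshelve. all: by end_near.
Qed.

Lemma near_right_itv (I : interval R) (m : R) :
  (\forall x \near m^'+, x \in I) \/ (\forall x \near m^'+, x \notin I).
Proof.
have side b (a : R) : (\forall x \near m^'+, (BSide b a <= BLeft x)%O) \/
    (\forall x \near m^'+, ~~ (BSide b a <= BLeft x)%O).
  have [am|ma] := leP a m.
    left; near=> x; have mx : m < x by near: x; exact: nbhs_right_gt.
    have ax : a < x := le_lt_trans am mx.
    by case: b; rewrite bnd_simp //= ltW.
  right; near=> x; have xa : x < a by near: x; exact: nbhs_right_lt.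
  by case: b; rewrite bnd_simp /= -?ltNge -?leNgt // ltW.
have side' b (a : R) : (\forall x \near m^'+, (BRight x <= BSide b a)%O) \/
    (\forall x \near m^'+, ~~ (BRight x <= BSide b a)%O).
  have [am|ma] := leP a m.
    right; near=> x; have mx : m < x by near: x; exact: nbhs_right_gt.
    have ax : a < x := le_lt_trans am mx.
    by case: b; rewrite bnd_simp /= -?ltNge -?leNgt // ltW.
  left; near=> x; have xa : x < a by near: x; exact: nbhs_right_lt.
  by case: b; rewrite bnd_simp //= ltW.
have lower (l : itv_bound R) : (\forall x \near m^'+, (l <= BLeft x)%O) \/
    (\forall x \near m^'+, ~~ (l <= BLeft x)%O).
  by case: l => [b a|[]]; [exact: side|left; near=> x|right; near=> x].
have upper (l : itv_bound R) : (\forall x \near m^'+, (BRight x <= l)%O) \/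
    (\forall x \near m^'+, ~~ (BRight x <= l)%O).
  by case: l => [b a|[]]; [exact: side'|right; near=> x|left; near=> x].
case: I => l u.
have [hl|hl] := lower l; last first.
  by right; apply: filterS hl => x; rewrite itv_boundlr negb_and => ->.
have [hu|hu] := upper u; last first.
  by right; apply: filterS hu => x; rewrite itv_boundlr negb_and => ->; rewrite orbT.
by left; apply: filterS2 hl hu => x; rewrite itv_boundlr => -> ->.
Unshelve. all: by end_near.
Qed.

(** In a finite union of intervals each endpoint lies on one side of the points
    close to [m] on its right. *)
Lemma near_right_dichotomy (A : R -> Prop) (m : R) : dpred1 E A ->
  (\forall x \near m^'+, A x) \/ (\forall x \near m^'+, ~ A x).
Proof.
move=> [p pA].
have [|s sE] := omin (A := A).
  exists p; apply/seteqP; split=> x; rewrite /defset /=; by rewrite pA.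
have {sE} AE x : A x <-> exists2 I, I \in s & x \in I by rewrite sE.
suff [h|h] : (\forall x \near m^'+, exists2 I, I \in s & x \in I) \/
    (\forall x \near m^'+, ~ exists2 I, I \in s & x \in I).
- by left; apply: filterS h => x /AE.
- by right; apply: filterS h => x h /AE.
elim: s {AE} => [|I s [IH|IH]].
- by right; near=> x => -[].
- by left; apply: filterS IH => x [J Js Jx]; exists J => //; rewrite inE Js orbT.
have [h|h] := near_right_itv I m.
  by left; apply: filterS h => x xI; exists I => //; rewrite mem_head.
right; apply: filterS2 h IH => x /negP xI nx [J].
by rewrite inE => /predU1P[->//|Js Jx]; apply: nx; exists J.
Unshelve. all: by end_near.
Qed.

Lemma near_right_frequently (A : R -> Prop) (m : R) : dpred1 E A ->
  ~ (\forall x \near m^'+, ~ A x) -> \forall x \near m^'+, A x.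
Proof. by move=> /(near_right_dichotomy m)[]. Qed.

Definition glb (A : R -> Prop) (m : R) :=
  (forall a, A a -> m <= a) /\ (forall l, (forall a, A a -> l <= a) -> l <= m).

Lemma glb_uniq (A : R -> Prop) m m' : glb A m -> glb A m' -> m = m'.
Proof. by move=> [l g] [l' g']; apply/eqP; rewrite eq_le g ?g'. Qed.

Lemma glb_exists (A : R -> Prop) l a :
  A a -> (forall a, A a -> l <= a) -> exists m, glb A m.
Proof.
move=> Aa Al; have hA : has_inf A by split; [exists a|exists l].
exists (inf A); split=> [b|b bA]; first exact: (ge_inf hA.2).
by apply: lb_le_inf => //; exists a.
Qed.

Lemma glb_lt (A : R -> Prop) m b : glb A m -> m < b -> exists2 a, A a & a < b.
Proof.
move=> [_ g] mb; apply: contrapT => h.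
suff /g : forall a, A a -> b <= a by rewrite leNgt mb.
by move=> a Aa; rewrite leNgt; apply/negP => ab; apply: h; exists a.
Qed.

(** A first-order recipe for a point of [A]: the infimum [m] of [A] if it lies
    in [A], and otherwise the middle of the interval of [A] that starts at [m]. The interval is cut at
    [m + 1] so that its right end [s] is finite, and this end is written as an
    infimum too. *)
Definition selected (A : R -> Prop) (z : R) :=
  exists m, glb A m /\ (A m /\ z = m \/ ~ A m /\
    exists s, glb (fun b => m < b /\ (~ A b \/ m + 1 <= b)) s /\ z + z = m + s).

Lemma selected_uniq A z z' : selected A z -> selected A z' -> z = z'.
Proof.
move=> [m [gm h]] [m' [gm' h']].
have mm' := glb_uniq gm gm'; rewrite -{}mm' {m' gm'} in h'.
case: h => [[Am zE]|[nAm [s [gs zE]]]]; case: h' => [[Am' zE']|[nAm' [s' [gs' zE']]]].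
- by rewrite zE zE'.
- by case: nAm'.
- by case: nAm.
- by rewrite -(glb_uniq gs gs') in zE'; lra.
Qed.

Lemma selected_exists A a : dpred1 E A -> (forall x, A x -> 0 <= x) -> A a ->
  exists z, selected A z /\ A z.
Proof.
move=> dA A0 Aa; have [m gm] := glb_exists Aa A0.
have [Am|nAm] := pselect (A m).
  by exists m; split=> //; exists m; split=> //; left.
pose B b := m < b /\ (~ A b \/ m + 1 <= b).
have [s gs] : exists s, glb B s.
  apply: (@glb_exists _ m (m + 1)); first by split; [lra|right].
  by move=> b [/ltW].
(* As [m] is not in [A], points of [A] accumulate at [m] from the right. *)
have mA : \forall x \near m^'+, A x.
  apply: near_right_frequently => // /near_rightP[d md nA].
  have [b Ab bd] := glb_lt gm md.
  have mb : m < b.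
    by rewrite lt_neqAle gm.1 // andbT; apply/eqP => mb; rewrite -mb in Ab.
  by apply: (nA b) => //; rewrite mb bd.
have {mA} [d md dA'] : exists2 d, m < d & forall x, m < x < d -> A x.
  by apply/near_rightP.
have ms : m < s.
  apply: lt_le_trans (gs.2 (Num.min d (m + 1)) _).
    by rewrite lt_min md; lra.
  move=> b [mb [nAb|mb1]]; rewrite ge_min; last by rewrite mb1 orbT.
  by rewrite leNgt; case: ltP => // bd; case: nAb; apply: dA'; rewrite mb.
exists ((m + s) / 2); split.
  by exists m; split=> //; right; split=> //; exists s; split=> //; lra.
apply: contrapT => nA.
have hB : B ((m + s) / 2) by split; [lra|left].
have := gs.1 _ hB; lra.
Qed.

(** Where the relation [P] has no solution, the value [0] is taken, which keeps
    the function total and definable. *)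
Lemma dfun_graph (P : R -> R -> Prop) : dpred2 E P ->
  (forall t z z', P t z -> P t z' -> z = z') ->
  exists2 f, dfun E f & forall t z, P t z -> f t = z.
Proof.
move=> dP uP; exists (fun t => xget 0 [set z | P t z]); last first.
  by move=> t z Pz; apply: xget_unique => // z' Pz'; exact: (uP _ _ _ Pz' Pz).
apply: (@defterm_graph _ _ _ _ _ (fun z e => P (e ord0) z \/
    ~ (exists z', P (e ord0) z') /\ z = 0)); last by definable.
move=> e z; case: xgetP => [z' _ Pz'|nP]; split.
- by move=> ->; left.
- by case=> [Pz|[h _]]; [exact: (uP _ _ _ Pz Pz')|case: h; exists z'; exact: Pz'].
- by move=> ->; right; split=> // -[z' /nP].
- by case=> [/nP|[]].
Qed.

(** The recipe [selected] needs sections bounded below, so it is applied to the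
    absolute values of the solutions; the sign is restored afterwards. *)
Lemma definable_choice (P : R -> R -> Prop) : dpred2 E P ->
  exists2 f, dfun E f & forall t, (exists a, P t a) -> P t (f t).
Proof.
move=> dP; pose Q t a := 0 <= a /\ (P t a \/ P t (- a)).
have dQ : dpred2 E Q by rewrite /Q; definable.
have [g dg gE] : exists2 g, dfun E g & forall t z, selected (Q t) z -> g t = z.
  apply: dfun_graph; last by move=> t z z'; apply: selected_uniq.
  rewrite /selected /glb; definable.
exists (fun t => if `[< P t (g t) >] then g t else - g t).
  apply: (@defterm_if _ _ _ _ (fun e => `[< P (e ord0) (g (e ord0)) >])).
  - apply: (@defpred_iff _ _ _ _ (fun e => P (e ord0) (g (e ord0)))); last by definable.
    by move=> e; split=> /asboolP.
  - by definable.
  - by definable.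
move=> t [a Pa].
have [|||z [sz Qz]] := @selected_exists (Q t) `|a|.
- have dt : dfun E (fun=> t) by rewrite /dfun; definable.
  by definable.
- by move=> x [].
- split; first exact: normr_ge0.
  by have [a0|a0] := ger0P a; [left|right; rewrite opprK].
rewrite -(gE _ _ sz) in Qz; case: asboolP => // nP.
by case: Qz => _ [].
Qed.
End Choice.

(** * The elementary embedding into the Hardy field *)

Section Hardy.
Variables (R : realType) (L : language) (E : structure L R).
Local Notation M := (expansion E).

(** A definable function on the positive reals may be arbitrary elsewhere; the
    value [0] there makes it definable on the whole line. *)
Definition fpos (f : R -> R) (x : R) : R := if 0 < x then f x else 0.

Lemma near_pos : \forall t \near (0 : R)^'+, 0 < t.
Proof. exact: nbhs_right_gt. Qed.

Lemma dfun_fpos f : definable_fun_pos M f -> dfun E (fpos f).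
Proof.
move=> /definable_fun_posP[p pE].
have dP : dpred2 E (fun t y => 0 < t /\ y = f t).
  exists p => e; rewrite -pE.
  suff <- : e = env2 (e ord0) (e ord_max) by [].
  apply/funext => i; rewrite /env2; case: eqP => [->//|/eqP i0].
  by congr e; apply/val_inj; case: i i0 => -[|[|]].
apply: (@defterm_graph _ _ _ _ _ (fun z e => (0 < e ord0 /\ z = f (e ord0)) \/
    (~ 0 < e ord0 /\ z = 0))) => [e z|].
  rewrite /fpos; case: ifP => e0; split=> [|[[]|[]]] //; by [left|right].
apply: defpred_or; last by definable.
by refine (@defpred2 _ _ _ _ _ _ _ dP _ _); definable.
Qed.

Lemma definable_fun_pos_dfun f : dfun E f -> definable_fun_pos M f.
Proof.
move=> df; apply/definable_fun_posP.
have [p pE] : dpred2 E (fun t y => 0 < t /\ y = f t) by definable.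
by exists p => t y; rewrite pE.
Qed.

Definition hrep (h : hardy E) : R -> R := fpos (hrepr h).

Lemma dfun_hrep h : dfun E (hrep h).
Proof. exact/dfun_fpos/definable_hrepr. Qed.

Lemma near_hrep h : \forall t \near 0^'+, hrep h t = hrepr h t.
Proof. by apply: filterS near_pos => t; rewrite /hrep /fpos => ->. Qed.

Lemma hrepr_germ f (df : definable_fun_pos M f) :
  \forall t \near 0^'+, hrepr (germ df) t = f t.
Proof.
pose x : defun E := exist _ f (asboolT df).
have /eqmodP/asboolP : \pi_({eq_quot (@germ_eq R L E)}) (repr (germ df)) =
    \pi_({eq_quot (@germ_eq R L E)}) x by rewrite reprK.
by [].
Qed.

Lemma hardy_eqP (h g : hardy E) :
  h = g <-> \forall t \near 0^'+, hrepr h t = hrepr g t.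
Proof.
split=> [->|hg]; first by near=> t.
rewrite -[h](@reprK _ {eq_quot (@germ_eq R L E)}).
rewrite -[g](@reprK _ {eq_quot (@germ_eq R L E)}).
by apply/eqmodP/asboolP.
Unshelve. all: by end_near.
Qed.

Lemma near_forall_ord k (P : 'I_k -> R -> Prop) :
  (forall i, \forall t \near 0^'+, P i t) -> \forall t \near 0^'+, forall i, P i t.
Proof.
move=> h; suff : \forall t \near 0^'+, forall i, i \in enum 'I_k -> P i t.
  by apply: filterS => t ht i; apply: ht; rewrite mem_enum.
elim: (enum _) => [|i s IH]; first by near=> t.
apply: filterS2 (h i) IH => t Pi Ps j; rewrite inE => /predU1P[->//|]; exact: Ps.
Unshelve. all: by end_near.
Qed.

Lemma hrepr_eval n (u : term (sum_lang oring_lang L) R n) (h : 'I_n -> hardy E) :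
  \forall t \near 0^'+, hrepr (Defs.eval (hardy_structure E) (@hcst R L E) h u) t =
    Defs.eval M id (fun i => hrepr (h i) t) u.
Proof.
elim: u => [i|a|F ts IH] /=; [by near=> t|exact: hrepr_germ|].
have := hrepr_germ (definable_app (F := F) (fun i =>
  definable_hrepr (Defs.eval (hardy_structure E) (@hcst R L E) h (ts i)))).
apply: filterS2 (near_forall_ord IH) => t ht ->.
by congr fint; apply/funext => i; apply: ht.
Unshelve. all: by end_near.
Qed.

Hypothesis omin : o_minimal M.

(** By induction on formulas: the negation step is the dichotomy near [0^'+], and
    the quantifier step is definable choice, which makes witnesses at each
    [t] into a germ. *)
Lemma sat_hardy n (p : formula (sum_lang oring_lang L) R n) (h : 'I_n -> hardy E) :
  sat (hardy_structure E) (@hcst R L E) p h <->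
  \forall t \near 0^'+, sat M id p (fun i => hrepr (h i) t).
Proof.
elim: p h => {n} [n u v|n r ts|n q IH|n q1 IH1 q2 IH2|n q IH] h /=.
- rewrite hardy_eqP.
  have [hu hv] := (hrepr_eval u h, hrepr_eval v h).
  split=> huv.
    by near=> t; rewrite -(near hu t) // -(near hv t) //; near: t.
  by near=> t; rewrite (near hu t) // (near hv t) //; near: t.
- have hts := near_forall_ord (fun i => hrepr_eval (ts i) h).
  by split; apply: filterS2 hts => t ht;
    (suff -> : (fun i => hrepr (Defs.eval (hardy_structure E) (@hcst R L E) h (ts i)) t) =
      (fun i => Defs.eval M id (fun i => hrepr (h i) t) (ts i)) by []); apply/funext.
- rewrite IH.
  split=> [nq|nq hq]; last exact: near_right_not hq nq.
  pose A t := sat M id q (fun i => hrep (h i) t).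
  have dA : dpred1 E A.
    apply: (@defpred_subst _ _ _ _ _ (sat M id q)); first exact: defpred_sat.
    by move=> i; apply: defterm1 (defterm_var _ _); apply: dfun_hrep.
  have AE : \forall t \near 0^'+, A t = sat M id q (fun i => hrepr (h i) t).
    apply: filterS (near_forall_ord (fun i => near_hrep (h i))) => t ht.
    by rewrite /A; congr sat; apply/funext.
  have [hA|hA] := near_right_dichotomy omin 0 dA.
    by case: nq; apply: filterS2 AE hA => t ->.
  by apply: filterS2 AE hA => t ->.
- rewrite IH1 IH2; split=> [[h1 h2]|h12]; first by apply: filterS2 h1 h2.
  by split; apply: filterS h12 => t [].
- have consE a t : env_cons (hrepr a t) (fun i => hrepr (h i) t) =
      (fun i => hrepr (env_cons a h i) t).
    by apply/funext => i; rewrite /env_cons; case: unliftP.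
  split=> [[a]|hq].
    by rewrite IH; apply: filterS => t ht; exists (hrepr a t); rewrite consE.
  pose P t a := sat M id q (env_cons a (fun i => hrep (h i) t)).
  have dP : dpred2 E P.
    pose f (i : 'I_n.+1) (e : 'I_2 -> R) :=
      env_cons (e ord_max) (fun i => hrep (h i) (e ord0)) i.
    apply: (@defpred_subst _ _ _ _ _ (sat M id q) f); first exact: defpred_sat.
    rewrite /f /env_cons => i; case: (unliftP ord0 i) => [j|] _ /=.
      exact: defterm1 (dfun_hrep _) (defterm_var _ _).
    exact: defterm_var.
  have [f df Pf] := definable_choice omin dP.
  pose a := germ (definable_fun_pos_dfun df).
  exists a; rewrite IH.
  apply: filterS3 hq (near_forall_ord (fun i => near_hrep (h i)))
    (hrepr_germ (definable_fun_pos_dfun df)) => t [b qb] ht aE.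
  have hE : (fun i => hrep (h i) t) = (fun i => hrepr (h i) t) by apply/funext.
  by rewrite -consE aE -hE; apply: Pf; exists b; rewrite /P hE.
Unshelve. all: by end_near.
Qed.

End Hardy.

(** * Asymptotics of definable functions *)

Section Asymptotics.
Variables (R : realType) (L : language) (E : structure L R).
Local Notation M := (expansion E).

Lemma near_lt (a : R) : 0 < a -> \forall t \near (0 : R)^'+, t < a.
Proof. exact: nbhs_right_lt. Qed.

Lemma near_ln_lt0 : \forall t \near (0 : R)^'+, ln t < 0.
Proof.
by apply: filterS2 (near_pos R) (near_lt ltr01) => t t0 t1; rewrite ln_lt0 // t0.
Qed.

Lemma near_ln_lt (a : R) : \forall t \near (0 : R)^'+, ln t < a.
Proof.
apply: filterS2 (near_pos R) (near_lt (expR_gt0 a)) => t t0 ta.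
by rewrite -[a]expRK ltr_ln // posrE expR_gt0.
Qed.

Lemma near_invl (P : R -> Prop) :
  (\forall x \near +oo, P x) -> \forall t \near 0^'+, P t^-1.
Proof.
move=> [m [_ mP]].
have m0 : 0 < `|m| + 1 by rewrite ltr_wpDl.
have m0' : 0 < (`|m| + 1)^-1 by rewrite invr_gt0.
apply: filterS2 (near_pos R) (near_lt m0') => t t0 tm; apply: mP.
have mt : `|m| + 1 < t^-1 by rewrite -[ltLHS]invrK ltf_pV2 ?posrE.
by apply: le_lt_trans (ler_norm m) (lt_trans _ mt); rewrite ltrDl.
Qed.

Lemma near_invr (P : R -> Prop) :
  (\forall t \near 0^'+, P t) -> \forall x \near +oo, P x^-1.
Proof.
move=> /near_rightP[d d0 dP]; exists d^-1; split; first exact: num_real.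
move=> x dx; have x0 : 0 < x by apply: lt_trans dx; rewrite invr_gt0.
by apply: dP; rewrite invr_gt0 x0 -[d]invrK ltf_pV2 ?posrE // invr_gt0.
Qed.

(** This says that [ln (f t) / ln t --> r] as [t --> 0^'+]; multiplying out by
    [ln t < 0] reverses the two bounds. *)
Definition has_order (f : R -> R) (r : R) := forall eps, 0 < eps ->
  \forall t \near 0^'+, (r + eps) * ln t <= ln (f t) <= (r - eps) * ln t.

Lemma has_order_inv f r : (\forall t \near 0^'+, 0 < f t) ->
  has_order f r -> has_order (fun t => (f t)^-1) (- r).
Proof.
move=> f0 fr eps e0; apply: filterS2 f0 (fr _ e0) => t ft0 /andP[h1 h2].
by rewrite lnV ?posrE //; apply/andP; split; lra.
Qed.

Lemma has_order_bounded f r a b : 0 < a ->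
  (\forall t \near 0^'+, a <= f t / t `^ r <= b) -> has_order f r.
Proof.
move=> a0 fab eps e0.
apply: filterS3 (near_pos R) fab (near_ln_lt (- ((`|ln a| + `|ln b|) / eps))).
move=> t t0 /andP[af fb] lt.
have tr0 := powR_gt0 r t0.
have q0 : 0 < f t / t `^ r by apply: lt_le_trans af.
have f0 : 0 < f t by move: q0; rewrite pmulr_lgt0 // invr_gt0.
have b0 : 0 < b by apply: lt_le_trans fb.
have la : ln a <= ln (f t) - r * ln t.
  by rewrite -ln_powR -ln_div ?posrE // ler_ln ?posrE.
have lb : ln (f t) - r * ln t <= ln b.
  by rewrite -ln_powR -ln_div ?posrE // ler_ln ?posrE.
have {lt} : `|ln a| + `|ln b| < - (eps * ln t).
  rewrite -mulrN -ltr_pdivrMl // mulrC; lra.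
have := ler_norm (- ln a); have := ler_norm (ln b); rewrite normrN.
have := normr_ge0 (ln a); have := normr_ge0 (ln b).
move=> ? ? ? ? ?; apply/andP; split; lra.
Qed.

Lemma has_order_uniq f r s : has_order f r -> has_order f s -> r = s.
Proof.
move=> fr fs; wlog rs : r s fr fs / r < s.
  by move=> h; have [||//] := ltgtP r s; [exact: h|move=> sr; apply/esym/h].
have e0 : 0 < (s - r) / 3 by lra.
have h : \forall t \near (0 : R)^'+, False.
  apply: filterS3 near_ln_lt0 (fr _ e0) (fs _ e0) => t t0 /andP[h1 _] /andP[_ h2].
  have {h1 h2} h : (r + (s - r) / 3) * ln t <= (s - (s - r) / 3) * ln t.
    exact: le_trans h1 h2.
  by move: h; rewrite leNgt ltr_nM2r //; apply/negP/negPn; lra.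
by have [] := near_right_ex h.
Qed.

Hypothesis omin : o_minimal M.
Hypothesis pbdd : polynomially_bounded M.

Lemma dfun_poly_bound f : dfun E f ->
  exists N : nat, \forall t \near 0^'+, f t <= t ^- N.
Proof.
move=> df.
have dF : definable_fun M (fun x => f x^-1).
  have [p pE] : dpred2 E (fun x y => y = f x^-1) by definable.
  by exists p; apply/seteqP; split=> x /=; rewrite /defset /= pE.
have [N /near_invl hN] := pbdd dF; exists N.
apply: filterS hN => t; rewrite invrK exprVn.
exact: le_trans (ler_norm _).
Qed.

(** For [q = (b - a) / m] the comparison is that of [f t ^+ m * t ^+ a] with
    [t ^+ b], which is definable even when [t `^ q] is not known to be. *)
Lemma near_ln_dichotomy f (q : rat) : dfun E f -> (\forall t \near 0^'+, 0 < f t) ->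
  (\forall t \near 0^'+, ln (f t) <= ratr q * ln t) \/
  (\forall t \near 0^'+, ratr q * ln t < ln (f t)).
Proof.
move=> df f0.
have [m [a [b [m0 qE]]]] : exists m a b : nat, (0 < m)%N /\
    ratr q * m%:R + a%:R = b%:R :> R.
  have d0 : (denq q)%:~R != 0 :> R by rewrite intr_eq0 denq_neq0.
  have [d dE] : exists d : nat, denq q = d%:Z by exists `|denq q|%N; rewrite gtz0_abs.
  have q_d : ratr q * d%:R = (numq q)%:~R :> R.
    by rewrite /ratr dE -pmulrn mulfVK // pmulrn -dE.
  have d1 : (0 < d)%N by rewrite -ltz_nat -dE.
  case nE : (numq q) q_d => [k|k] q_d.
    by exists d, 0%N, k; split=> //; rewrite q_d addr0.
  by exists d, k.+1, 0%N; split=> //; rewrite q_d NegzE mulrNz addNr.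
have mp : 0 < m%:R :> R by rewrite ltr0n.
have lnE t : 0 < t -> 0 < f t -> (f t ^+ m * t ^+ a <= t ^+ b) =
    (ln (f t) <= ratr q * ln t).
  move=> t0 ft0; rewrite -ler_ln ?posrE ?mulr_gt0 ?exprn_gt0 //.
  rewrite lnM ?posrE ?exprn_gt0 // !lnXn // -!(mulr_natr (ln _)) -qE.
  rewrite -[RHS](ler_pM2r mp) -[LHS]subr_ge0 -[RHS]subr_ge0.
  by congr (0 <= _); ring.
have dA : dpred1 E (fun t => f t ^+ m * t ^+ a <= t ^+ b) by definable.
have [h|h] := near_right_dichotomy omin 0 dA; [left|right].
  by apply: filterS3 (near_pos R) f0 h => t t0 ft0; rewrite lnE.
by apply: filterS3 (near_pos R) f0 h => t t0 ft0; rewrite lnE // ltNge => /negP.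
Qed.

(** The order is the supremum of the exponents [q] with [f t <= t `^ q] near
    [0^'+]; a rational just above it is not such an exponent, so by the
    dichotomy it bounds [f] from below. *)
Lemma has_order_exists f : dfun E f -> (\forall t \near 0^'+, 0 < f t) ->
  exists r, has_order f r.
Proof.
move=> df f0.
have lnb g : dfun E g -> (\forall t \near 0^'+, 0 < g t) ->
    exists N : nat, \forall t \near 0^'+, ln (g t) <= - (N%:R * ln t).
  move=> dg g0; have [N hN] := dfun_poly_bound dg; exists N.
  apply: filterS3 (near_pos R) g0 hN => t t0 gt0.
  rewrite -ler_ln ?posrE ?invr_gt0 ?exprn_gt0 // lnV ?posrE ?exprn_gt0 // lnXn //.
  by rewrite mulr_natl.
pose S : set R := [set q | \forall t \near 0^'+, ln (f t) <= q * ln t].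
have [N hN] := lnb _ df f0.
have [N' hN'] : exists N : nat, \forall t \near 0^'+, - ln (f t) <= - (N%:R * ln t).
  have [||N' h] := lnb (fun t => (f t)^-1).
  - by definable.
  - by apply: filterS f0 => t; rewrite invr_gt0.
  by exists N'; apply: filterS2 f0 h => t ft0; rewrite lnV ?posrE.
have S0 : S (- N%:R) by apply: filterS hN => t; rewrite mulNr.
have Sub : ubound S N'%:R.
  move=> q Sq; rewrite leNgt; apply/negP => qN.
  have h : \forall t \near (0 : R)^'+, False.
    apply: filterS3 near_ln_lt0 Sq hN' => t t0 h1 h2.
    have : N'%:R * ln t <= q * ln t by lra.
    by rewrite leNgt ltr_nM2r // qN.
  by have [] := near_right_ex h.
have hS : has_sup S by split; [exists (- N%:R)|exists N'%:R].
exists (sup S) => eps e0.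
have [q Sq qr] := sup_adherent e0 hS.
have /rat_in_itvoo[p] : sup S < sup S + eps by lra.
rewrite in_itv /= => /andP[p1 p2].
have hp : \forall t \near 0^'+, ratr p * ln t < ln (f t).
  have [h|//] := near_ln_dichotomy p df f0.
  by have := ub_le_sup hS.2 (h : S (ratr p)); rewrite leNgt p1.
apply: filterS3 near_ln_lt0 Sq hp => t t0 h1 h2; apply/andP; split.
  by apply: ltW (le_lt_trans _ h2); rewrite ler_nM2r // ltW.
by apply: le_trans h1 _; rewrite ler_nM2r // ltW.
Qed.
End Asymptotics.

(** * Definability of power functions *)

Section Powers.
Variables (R : realType) (L : language) (E : structure L R).
Local Notation M := (expansion E).
Hypothesis omin : o_minimal M.

(** If the inequality failed near [0], iterating [t |-> t * y] would produce a
    sequence tending to [0] along which [f] is too large for its order. *)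
Lemma ratio_le f r s y : dfun E f -> (\forall t \near 0^'+, 0 < f t) ->
  has_order f r -> s < r -> 0 < y < 1 ->
  \forall t \near 0^'+, f (t * y) <= y `^ s * f t.
Proof.
move=> df f0 fr sr /andP[y0 y1].
have dA : dpred1 E (fun t => f (t * y) <= y `^ s * f t) by definable.
have [//|hA] := near_right_dichotomy omin 0 dA.
have e0 : 0 < (r - s) / 2 by lra.
have [d d0 hd] := (near_rightP _ _).1 (filterI hA (filterI f0 (fr _ e0))).
pose t k := d / 2 * y ^+ k.
have t0 k : 0 < t k by rewrite mulr_gt0 ?exprn_gt0 // divr_gt0.
have td k : t k < d.
  have : y ^+ k <= 1 by rewrite exprn_ile1 // ltW.
  move=> yk; apply: (@le_lt_trans _ _ (d / 2)); last by lra.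
  by rewrite ler_piMr // divr_ge0 // ltW.
have ht k : ~ (f (t k.+1) <= y `^ s * f (t k)) /\ 0 < f (t k) /\
    (r + (r - s) / 2) * ln (t k) <= ln (f (t k)) <= (r - (r - s) / 2) * ln (t k).
  have -> : t k.+1 = t k * y by rewrite /t exprSr mulrA.
  have tkd : 0 < t k < d by rewrite t0 td.
  exact: (hd _ tkd).
have hk k : k%:R * (s * ln y) + ln (f (t 0%N)) <= ln (f (t k)).
  elim: k => [|k IH]; first by rewrite mul0r add0r.
  have [/negP + [ft _]] := ht k; rewrite -ltNge => h.
  have : ln (y `^ s * f (t k)) <= ln (f (t k.+1)).
    by rewrite ler_ln ?posrE ?mulr_gt0 ?powR_gt0 //; [exact: ltW|case: (ht k.+1) => _ []].
  rewrite lnM ?posrE ?powR_gt0 // ln_powR; apply: le_trans.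
  by rewrite mulrSr; lra.
have lny : ln y < 0 by rewrite ln_lt0 // y0.
pose c := (r - s) / 2 * (- ln y).
have c0 : 0 < c by rewrite mulr_gt0 // oppr_gt0.
pose B := (r - (r - s) / 2) * ln (t 0%N) - ln (f (t 0%N)).
have [k Bk] : exists k : nat, B / c < k%:R.
  by exists (Num.truncn (B / c)).+1; exact: truncnS_gt.
suff : k%:R * c <= B by rewrite leNgt -ltr_pdivrMr // Bk.
have [_ [_ /andP[_ hi]]] := ht k; have lo := le_trans (hk k) hi.
have tkE : ln (t k) = ln (t 0%N) + k%:R * ln y.
  by rewrite /t lnM ?posrE ?divr_gt0 ?exprn_gt0 // lnXn // expr0 mulr1 mulr_natl.
by rewrite tkE in lo; rewrite /B /c; lra.
Qed.

(** The factor [w] absorbs the passage from [r] to the exponents on both sides of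
    it; the lower bound is [ratio_le] for the inverse of [f]. *)
Lemma ratio_cvg f r y w : dfun E f -> (\forall t \near 0^'+, 0 < f t) ->
  has_order f r -> 0 < y < 1 -> 1 < w ->
  \forall t \near 0^'+, f (t * y) <= w * y `^ r * f t /\
                        y `^ r * f t <= w * f (t * y).
Proof.
move=> df f0 fr /[dup] y01 /andP[y0 y1] w1.
(* This [s] satisfies [y `^ (- s) = w]. *)
have lny : ln y < 0 by rewrite ln_lt0.
have lnw : 0 < ln w by rewrite ln_gt0.
pose s := - (ln w / ln y).
have s0 : 0 < s by rewrite /s -mulrN -invrN divr_gt0 // oppr_gt0.
have wE : y `^ (- s) = w.
  rewrite -[LHS]lnK ?posrE ?powR_gt0 // ln_powR opprK divfK ?lt_eqF //.
  by rewrite lnK // posrE (lt_trans ltr01).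
have f0y : \forall t \near 0^'+, 0 < f (t * y).
  move/near_rightP: f0 => [d d0 hd]; apply/near_rightP; exists d => // t /andP[t0 td].
  by apply: hd; rewrite mulr_gt0 //=; apply: lt_trans td; rewrite gtr_pMr.
have dfi : dfun E (fun t => (f t)^-1) by definable.
have fi0 : \forall t \near 0^'+, 0 < (f t)^-1.
  by apply: filterS f0 => t; rewrite invr_gt0.
have rs : r - s < r by lra.
have rs' : - r - s < - r by lra.
apply: filterS3 f0 f0y (filterI (ratio_le df f0 fr rs y01)
  (ratio_le dfi fi0 (has_order_inv f0 fr) rs' y01)) => t ft fty [/=].
have yr0 := powR_gt0 r y0.
rewrite !powRD ?(gt_eqF y0) ?implybT // wE powRN => l1 l2; split.
  by rewrite (mulrC w).
move: l2; rewrite -[_ * w * _]mulrA [w * _]mulrC mulrA -invfM.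
rewrite ler_pdivlMl ?mulr_gt0 // -ler_pdivlMr ?invr_gt0 //.
by rewrite invrK.
Qed.

(** The value [y `^ r] is the only [z] such that [f (t * y) / f t --> z] as [t]
    tends to [0], and this is a first-order condition on [y] and [z]. *)
Lemma power_definable f r : dfun E f -> (\forall t \near 0^'+, 0 < f t) ->
  has_order f r -> exists2 p, dfun E p & \forall t \near 0^'+, p t = t `^ r.
Proof.
move=> df f0 fr.
pose P y z := (0 < y /\ y < 1) /\ 0 < z /\ forall w, 1 < w ->
  exists d, 0 < d /\ forall t, 0 < t -> t < d ->
    f (t * y) <= w * z * f t /\ z * f t <= w * f (t * y).
have dP : dpred2 E P by rewrite /P; definable.
have Pz y z z' : P y z -> P y z' -> z <= z'.
  move=> [[y0 y1] [z0 hz]] [_ [z0' hz']]; rewrite leNgt; apply/negP => zz.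
  (* With this [w], [z / z' <= w ^+ 2] is contradictory. *)
  pose w := expR ((ln z - ln z') / 4).
  have l0 : 0 < ln z - ln z' by rewrite subr_gt0 ltr_ln.
  have w1 : 1 < w by rewrite -expR0 ltr_expR; lra.
  have w0 : 0 < w by apply: expR_gt0.
  have [d [d0 hd]] := hz _ w1; have [d' [d0' hd']] := hz' _ w1.
  have [d'' d0'' hd''] := (near_rightP _ _).1 f0.
  pose m := Num.min d (Num.min d' d''); have m0 : 0 < m by rewrite !lt_min d0 d0' d0''.
  have [t0 tm] : 0 < m / 2 /\ m / 2 < m by split; lra.
  move: tm; set t := m / 2 in t0 *; rewrite !lt_min => /and3P[td td' td''].
  have ft : 0 < f t by apply: hd''; rewrite t0.
  have [_ h1] := hd _ t0 td; have [h2 _] := hd' _ t0 td'.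
  have h3 : z * f t <= w * (w * z' * f t).
    by apply: le_trans h1 _; rewrite ler_pM2l.
  have {h3} : z <= w * (w * z') by rewrite -(ler_pM2r ft) -!mulrA; rewrite -!mulrA in h3.
  rewrite -ler_ln ?posrE ?mulr_gt0 // !lnM ?posrE ?mulr_gt0 // /w !expRK; lra.
have [p dp hp] : exists2 p, dfun E p & forall y z, P y z -> p y = z.
  by apply: dfun_graph => // y z z' h h'; apply/eqP; rewrite eq_le !(Pz y).
exists p => //; apply: filterS2 (near_pos R) (near_lt ltr01) => y y0 y1; apply: hp.
split=> //; split; first exact: powR_gt0.
move=> w w1.
have [|d d0 hd] := (near_rightP _ _).1 (ratio_cvg df f0 fr (_ : 0 < y < 1) w1).
  by rewrite y0.
by exists d; split=> // t t0 td; apply: hd; rewrite t0.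
Qed.
End Powers.

(** * Definable functions are asymptotic to multiples of powers *)

Section PowerAsymptotics.
Variables (R : realType) (L : language) (E : structure L R).
Local Notation M := (expansion E).
Hypothesis omin : o_minimal M.
Hypothesis pbdd : polynomially_bounded M.

(** An unbounded [g] would tend to infinity, slower than any negative power; a definable
    solution [t < x] of [1 / x <= g t] would then tend to [0] faster than any
    power of [x], against polynomial boundedness. *)
Lemma order0_bounded g : dfun E g -> (\forall t \near 0^'+, 0 < g t) ->
  has_order g 0 -> exists2 C, 0 < C & \forall t \near 0^'+, g t <= C.
Proof.
move=> dg g0 gr; apply: contrapT => nb.
have gC C : 0 < C -> \forall t \near 0^'+, C < g t.
  move=> C0; have dA : dpred1 E (fun t => g t <= C) by definable.
  have [h|h] := near_right_dichotomy omin 0 dA; first by case: nb; exists C.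
  by apply: filterS h => t /negP; rewrite ltNge.
pose P x t := 0 < t /\ t < x /\ 1 <= x * g t.
have dP : dpred2 E P by rewrite /P; definable.
have [phi dphi hphi] := definable_choice omin dP.
have {}hphi x : 0 < x -> P x (phi x).
  move=> x0; apply: hphi; have xi0 : 0 < x^-1 by rewrite invr_gt0.
  have [d d0 hd] := (near_rightP _ _).1 (gC _ xi0).
  pose t := Num.min x d / 2; have m0 : 0 < Num.min x d by rewrite lt_min x0.
  have [t0 tm] : 0 < t /\ t < Num.min x d by rewrite /t; split; lra.
  move: tm; rewrite lt_min => /andP[tx td]; exists t; split=> //; split=> //.
  by rewrite -ler_pdivrMl // mulr1 ltW // hd // t0.
have dphi' : dfun E (fun x => (phi x)^-1) by definable.
have [N hN] := dfun_poly_bound pbdd dphi'.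
(* The inverse of [phi] is at most [x ^- N], hence [g (phi x)] is at most
   [x `^ (- (N * eps))], with [N * eps < 1]. *)
pose eps : R := N.+1%:R^-1.
have e0 : 0 < eps by rewrite invr_gt0.
have [d d0 hd] := (near_rightP _ _).1 (gr _ e0).
have h : \forall x \near (0 : R)^'+, False.
  apply: filterS3 (filterI (near_pos R) (near_lt d0)) (near_ln_lt0 R) hN.
  move=> x [x0 xd] lx hx; have [p0 [px gx]] := hphi _ x0.
  have gx0 : 0 < g (phi x).
    by rewrite -(pmulr_rgt0 _ x0); apply: lt_le_trans gx.
  have h1 : N%:R * ln x <= ln (phi x).
    have : x ^+ N <= phi x by rewrite -lef_pV2 ?posrE ?exprn_gt0.
    by rewrite -[_ <= phi x]ler_ln ?posrE ?exprn_gt0 // lnXn // mulr_natl.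
  have h2 : - ln x <= ln (g (phi x)).
    by rewrite -lnV ?posrE // ler_ln ?posrE ?invr_gt0 // -[x^-1]mulr1 ler_pdivrMl.
  have [|_ h3] := andP (hd (phi x) _); first by rewrite p0 (lt_trans px).
  have h4 : eps * (N%:R * ln x) <= eps * ln (phi x) by rewrite ler_pM2l.
  have h5 : eps * N%:R = 1 - eps.
    by rewrite /eps -[N%:R](addrK 1) -mulrSr mulrBr mulr1 mulVf // pnatr_eq0.
  have : - ln x <= - ((1 - eps) * ln x) by rewrite -h5 -mulrA; lra.
  have : eps * ln x < 0 by rewrite pmulr_rlt0.
  lra.
by have [] := near_right_ex h.
Qed.

(** The limit is the supremum of the eventual lower bounds of [g]: by the dichotomy
    any larger number is an eventual strict upper bound. *)
Lemma bounded_cvg (g : R -> R) (a b : R) : dfun E g -> (\forall t \near 0^'+, a <= g t <= b) ->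
  exists2 c : R, a <= c & g t @[t --> 0^'+] --> c.
Proof.
move=> dg hab.
pose S : set R := [set x | \forall t \near 0^'+, x <= g t].
have Sa : S a by apply: filterS hab => t /andP[].
have Sub : ubound S b.
  move=> x Sx; have [t [/andP[_ gb] xg]] :=
    @filter_ex _ _ (at_right_proper_filter 0) _ (filterI hab Sx).
  exact: le_trans xg gb.
have hS : has_sup S by split; [exists a|exists b].
exists (sup S); first exact: ub_le_sup hS.2 _ Sa.
apply/cvgrPdist_le => eps e0.
have [q Sq qr] := sup_adherent e0 hS.
have dA : dpred1 E (fun t => sup S + eps <= g t) by definable.
have [h|h] := near_right_dichotomy omin 0 dA.
  by have := ub_le_sup hS.2 (h : S (sup S + eps)); lra.
apply: filterS2 h Sq => t /negP; rewrite -ltNge => h1 h2.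
by rewrite ler_norml; lra.
Qed.

Lemma bounded_power_cvg (f : R -> R) (r a b : R) : dfun E f -> 0 < a ->
  (\forall t \near 0^'+, a <= f t / t `^ r <= b) ->
  exists2 c : R, 0 < c & f t / t `^ r @[t --> 0^'+] --> c.
Proof.
move=> df a0 hab; have fr := has_order_bounded a0 hab.
have f0 : \forall t \near 0^'+, 0 < f t.
  apply: filterS2 (near_pos R) hab => t t0 /andP[h _].
  by have := lt_le_trans a0 h; rewrite pmulr_lgt0 // invr_gt0 powR_gt0.
have [p dp hp] := power_definable omin df f0 fr.
have dg : dfun E (fun t => f t * (p t)^-1) by definable.
have [|c ac hc] := @bounded_cvg (fun t => f t * (p t)^-1) a b dg.
  by apply: filterS2 hab hp => t + ->.
exists c; first exact: lt_le_trans ac.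
by apply: cvg_trans hc; apply: near_eq_cvg; apply: filterS hp => t ->.
Qed.

Lemma power_asymptotics (f : R -> R) : dfun E f -> (\forall t \near 0^'+, 0 < f t) ->
  exists r c : R, [/\ has_order f r, 0 < c & f t / t `^ r @[t --> 0^'+] --> c].
Proof.
move=> df f0; have [r fr] := has_order_exists omin pbdd df f0.
have [p dp hp] := power_definable omin df f0 fr.
pose g t := f t / p t.
have dg : dfun E g by rewrite /g; definable.
have g0 : \forall t \near 0^'+, 0 < g t.
  apply: filterS3 (near_pos R) f0 hp => t t0 ft pt.
  by rewrite /g pt divr_gt0 // powR_gt0.
have gr : has_order g 0.
  move=> eps e0; apply: filterS3 (filterI (near_pos R) hp) f0 (fr _ e0).
  move=> t [t0 pt] ft; rewrite /g pt ln_div ?posrE ?powR_gt0 // ln_powR; lra.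
have [b b0 hb] := order0_bounded dg g0 gr.
have dgi : dfun E (fun t => (g t)^-1) by definable.
have gi0 : \forall t \near 0^'+, 0 < (g t)^-1.
  by apply: filterS g0 => t; rewrite invr_gt0.
have gir : has_order (fun t => (g t)^-1) 0.
  by have := has_order_inv g0 gr; rewrite oppr0.
have [a a0 ha] := order0_bounded dgi gi0 gir.
have hab : \forall t \near 0^'+, a^-1 <= f t / t `^ r <= b.
  apply: filterS3 (filterI g0 hp) ha hb => t [gt pt]; rewrite /g pt in gt * => ha' ->.
  by rewrite andbT -[leRHS]invrK lef_pV2 // posrE invr_gt0.
have ai0 : 0 < a^-1 by rewrite invr_gt0.
have [c c0 hc] := bounded_power_cvg df ai0 hab.
by exists r, c.
Qed.

(** Positivity of [f] forces [0 < c]. *)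
Lemma cvg_has_order (f : R -> R) (r c : R) : c != 0 -> (\forall t \near 0^'+, 0 < f t) ->
  f t / t `^ r @[t --> 0^'+] --> c -> has_order f r.
Proof.
move=> c0 f0 /cvgrPdist_le hc.
have c2 : 0 < `|c| / 2 by rewrite divr_gt0 // normr_gt0.
apply: (@has_order_bounded _ f r (`|c| / 2) (2 * `|c|)) => //.
apply: filterS3 (near_pos R) f0 (hc _ c2) => t t0 ft.
have : 0 < f t / t `^ r by rewrite divr_gt0 // powR_gt0.
set q := f t / _ => q0; rewrite ler_norml => /andP[h1 h2].
have cp : 0 < c.
  rewrite lt_neqAle eq_sym c0 /= leNgt; apply/negP => cn.
  by rewrite ltr0_norm // in h1; lra.
by rewrite gtr0_norm // in h1 h2 *; apply/andP; split; lra.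
Qed.

Lemma germ_asymptotics (h : hardy E) : (\forall t \near 0^'+, 0 < hrepr h t) ->
  exists r c : R, [/\ has_order (hrepr h) r, 0 < c &
    hrepr h t / t `^ r @[t --> 0^'+] --> c].
Proof.
move=> h0; have hE := near_hrep h.
have h0' : \forall t \near 0^'+, 0 < hrep h t by apply: filterS2 h0 hE => t + ->.
have [r [c [hr c0 hc]]] := power_asymptotics (dfun_hrep h) h0'.
exists r, c; split=> // [eps e0|].
  by apply: filterS2 hE (hr _ e0) => t ->.
by apply: cvg_trans hc; apply: near_eq_cvg; apply: filterS hE => t ->.
Qed.

(** The set whose element [hval] picks is nonempty by [germ_asymptotics], and
    each of its elements is the order of the germ. *)
Lemma hval_has_order (h : hardy E) r : (\forall t \near 0^'+, 0 < hrepr h t) ->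
  has_order (hrepr h) r -> hval h = r.
Proof.
move=> h0 hr; have [s [c [_ c0 hc]]] := germ_asymptotics h0.
have [|c' c'0 /(cvg_has_order c'0 h0) hr'] := getPex (P := [set r : R |
    exists2 c : R, c != 0 & hrepr h t / t `^ r @[t --> 0^'+] --> c]).
  by exists s, c => //; rewrite gt_eqF.
exact: has_order_uniq hr' hr.
Qed.

End PowerAsymptotics.

(** * Logarithmic limit sets *)

Section LogLimit.
Variables (R : realType) (L : language) (E : structure L R).
Local Notation M := (expansion E).
Hypothesis omin : o_minimal M.
Hypothesis pbdd : polynomially_bounded M.

Lemma dfun_definable_fun (F : R -> R) : definable_fun M F <-> dfun E F.
Proof.
split=> [[p pE]|dF].
  apply: (@defterm_graph _ _ _ _ _ (fun z e => z = F (e ord0))) => //.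
  have dP : dpred2 E (fun x y => y = F x).
    exists p => e.
    have -> : e = (\row_i e i) ord0 by apply/funext => i; rewrite mxE.
    by rewrite -[sat _ _ _ _]/(defset M p _) -pE /= !mxE.
  by definable.
have [p pE] : dpred2 E (fun x y => y = F x) by definable.
by exists p; apply/seteqP; split=> x /=; rewrite /defset /= pE.
Qed.

Lemma powR_invl (a r : R) : 0 <= a -> a^-1 `^ r = a `^ (- r).
Proof. by move=> a0; rewrite -powR_inv1 // -powRrM mulN1r. Qed.

(** The function that witnesses the exponent [r] at infinity has order [- r] at
    [0^'+] after inverting its argument and fixing its sign. *)
Lemma exponent_power r : field_of_exponents M r ->
  exists2 p, dfun E p & \forall t \near 0^'+, p t = t `^ r.
Proof.
move=> [F [/dfun_definable_fun dF [c c0 /cvgrPdist_le hc]]].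
have c2 : 0 < `|c| / 2 by rewrite divr_gt0 // normr_gt0.
pose f t := Num.sg c * F t^-1.
have df : dfun E f by rewrite /f; definable.
have hf : \forall t \near 0^'+, `|c| / 2 <= f t / t `^ (- r) <= 2 * `|c|.
  apply: filterS2 (near_pos R) (near_invl (hc _ c2)) => t t0.
  rewrite (powR_invl _ (ltW t0)) /f -mulrA; set q := F _ / _.
  rewrite ler_norml => /andP[h1 h2].
  have [cp|cn] : 0 < c \/ c < 0 by case: (ltgtP c 0) c0 => //; [right|left].
    by rewrite gtr0_sg // mul1r; rewrite gtr0_norm // in h1 h2 *; apply/andP; split; lra.
  by rewrite ltr0_sg // mulN1r; rewrite ltr0_norm // in h1 h2 *; apply/andP; split; lra.
have f0 : \forall t \near 0^'+, 0 < f t.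
  apply: filterS2 (near_pos R) hf => t t0 /andP[h _].
  by have := lt_le_trans c2 h; rewrite pmulr_lgt0 // invr_gt0 powR_gt0.
have [p dp hp] := power_definable omin df f0 (has_order_bounded c2 hf).
exists (fun t => (p t)^-1); first by definable.
by apply: filterS hp => t ->; rewrite powRN invrK.
Qed.

Lemma cvg_exponent f r c : dfun E f -> c != 0 ->
  f t / t `^ r @[t --> 0^'+] --> c -> field_of_exponents M (- r).
Proof.
move=> df c0 /cvgrPdist_le hc; exists (fun x => f x^-1); split.
  by apply/dfun_definable_fun; definable.
exists c => //; apply/cvgrPdist_le => eps e0.
have hx : \forall x \near +oo, (0 : R) < x by exact: nbhs_pinfty_gt.
apply: filterS2 hx (near_invr (hc _ e0)) => x x0.
by rewrite (powR_invl _ (ltW x0)).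
Qed.

Lemma defset_row n (phi : formula (sum_lang oring_lang L) R n) (e : 'I_n -> R) :
  defset M phi (\row_i e i) <-> sat M id phi e.
Proof.
rewrite /defset /=.
by have -> : (\row_i e i) ord0 = e by apply/funext => i; rewrite mxE.
Qed.

(** The logarithms of the curve [t |-> (h i) t] in base [1 / t] are
    [- ln (h i t) / ln t], and tend to [- r i]. *)
Lemma germs_in_limit n (V : set 'rV[R]_n) (h : 'I_n -> hardy E) (r : 'I_n -> R) :
  (\forall t \near 0^'+, V (\row_i hrepr (h i) t)) ->
  (forall i, has_order (hrepr (h i)) (r i)) ->
  log_limit_set V (\row_i - r i).
Proof.
move=> hV hr; rewrite /log_limit_set /lim_family /= => B [[B1 B2] /= [hB1 hB2] sB].
have /nbhs_ballP[eps /= e0 hball] := hB1.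
have e2 : 0 < eps / 2 by lra.
have hlog := near_forall_ord (fun i => hr i _ e2).
have hB2' : \forall t \near (0 : R)^'+, B2 t by apply: cvg_within.
have hB : \forall t \near (0 : R)^'+,
    ([set p : 'rV[R]_n * R | 0 < p.2 < 1 /\ amoeba V p.2 p.1] `&` B)
      (Log_base t^-1 (\row_i hrepr (h i) t), t).
  apply: filterS3 (filterI (near_pos R) (near_lt ltr01)) (filterI hV hB2') hlog.
  move=> t [t0 t1] [Vt B2t] ht; split => /=.
    by split; [rewrite t0 t1|exists (\row_i hrepr (h i) t)].
  apply: sB; split=> //=; apply: hball; split=> // i j.
  rewrite !mxE /ball /= lnV ?posrE //.
  have lt : ln t < 0 by rewrite ln_lt0 // t0.
  have /andP[] := ht j; set l := ln (hrepr _ _).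
  have -> : l = l / ln t * ln t by rewrite divfK // lt_eqF.
  rewrite !ler_nM2r // invrN mulrN mulfK ?lt_eqF // => h1 h2.
  by rewrite ltr_norml; apply/andP; split; lra.
by have [x hx] := near_right_ex hB; exists (Log_base x^-1 (\row_i hrepr (h i) x), x).
Qed.

End LogLimit.

(** * Lifting points of the limit to germs *)

Section Lifting.
Variables (R : realType) (L : language) (E : structure L R).
Local Notation M := (expansion E).
Hypothesis omin : o_minimal M.
Hypothesis pbdd : polynomially_bounded M.

(** Membership in the closure, with the denominators [ln t^-1] cleared. *)
Lemma limit_frequently n (V : set 'rV[R]_n) (y : 'rV[R]_n) eps d :
  log_limit_set V y -> 0 < eps -> 0 < d ->
  exists x t, [/\ V x, 0 < t < d, t < 1 & forall i,
    (y ord0 i - eps) * - ln t < ln (x ord0 i) < (y ord0 i + eps) * - ln t].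
Proof.
move=> yV e0 d0.
have nbhs_yd : nbhs (y, 0 : R) (ball y eps `*` ball (0 : R) d).
  by exists (ball y eps, ball (0 : R) d) => //; split; exact: nbhsx_ballx.
have [[z t] /= [[/andP[t0 t1] [x Vx zE]] [[_ yz] td]]] := yV _ nbhs_yd.
exists x, t; split=> //.
  by move: td; rewrite /ball /= sub0r normrN gtr0_norm // t0.
move=> i; have := yz ord0 i; rewrite -zE !mxE /ball /= lnV ?posrE //.
have lt : ln t < 0 by rewrite ln_lt0 // t0.
set l := ln _; rewrite invrN mulrN opprK ltr_norml => /andP[h1 h2].
have -> : l = - (l / ln t) * - ln t by rewrite mulrNN divfK // lt_eqF.
by rewrite !ltr_pM2r ?oppr_gt0 //; apply/andP; split; lra.
Qed.

Section Lift.
Variables (n : nat) (phi : formula (sum_lang oring_lang L) R n) (q : 'I_n -> R -> R).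
Hypothesis dq : forall i, dfun E (q i).

(** The function [q i] stands for [t `^ y_i], so that the coordinates of [x] are
    compared with [t `^ (- y_i)]. *)
Definition controlled (t C : R) (x : 'I_n -> R) :=
  sat M id phi x /\ forall i, x i * q i t <= C /\ 1 <= C * (x i * q i t).

Lemma controlled_le t C C' x : 1 <= C -> C <= C' ->
  controlled t C x -> controlled t C' x.
Proof.
move=> C1 CC' [px hx]; split=> // i; have [h1 h2] := hx i.
have C0 : 0 < C by apply: lt_le_trans C1.
have q0 : 0 < x i * q i t by rewrite -(pmulr_rgt0 _ C0); apply: lt_le_trans h2.
split; first exact: le_trans CC'.
by apply: le_trans h2 _; rewrite ler_pM2r.
Qed.

(** The bound [1 <= C], automatic for [C] positive when there is a coordinate,
    prevents [C] from being halved indefinitely in dimension [0]. *)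
Definition controllable (t C : R) := 1 <= C /\ exists x, controlled t C x.

Lemma dpred2_controllable : dpred2 E controllable.
Proof.
apply: defpred_and; first by definable.
apply: defpred_exn; apply: defpred_and.
  exact: (defpred_ren (lshift 2) (defpred_sat E phi)).
apply: defpred_forall_ord => i.
have dqi : dfun E (q i) by apply: dq.
by definable.
Qed.

(** Choose definably a bound [c t] that cannot be halved: it is less than twice
    any other bound at [t]. Being at least [1] and frequently at most
    [2 * t `^ (- eps)], it has order [0], so it is bounded near [0^'+]. *)
Lemma controlled_uniformly :
  (forall eps d : R, 0 < eps -> 0 < d ->
     exists2 t : R, 0 < t < d & controllable t (t `^ (- eps))) ->
  exists2 K : R, 1 <= K & \forall t \near 0^'+, exists x, controlled t K x.
Proof.
move=> freq.
have dc := dpred2_controllable.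
pose P t C := controllable t C /\ ~ controllable t (C / 2).
have dP : dpred2 E P by rewrite /P; definable.
have exP t C : controllable t C -> exists C', P t C'.
  move=> tC; have [k Ck] : exists k : nat, C < 2 ^+ k.
    exists (Num.bound C); apply: upper_nthrootP; exact: leqnn.
  elim: k C Ck tC => [|k IH] C Ck tC.
    by case: tC; rewrite leNgt; rewrite expr0 in Ck; rewrite Ck.
  have [h|h] := pselect (controllable t (C / 2)); last by exists C.
  by apply: IH h; rewrite exprS in Ck; lra.
have [c dfc hc] := definable_choice omin dP.
have nearP : \forall t \near 0^'+, P t (c t).
  have dA : dpred1 E (fun t => exists C, controllable t C) by definable.
  have [h|/near_rightP[d d0 hd]] := near_right_dichotomy omin 0 dA.
    by apply: filterS h => t [C /exP]; apply: hc.
  by have [t td tC] := freq 1 d ltr01 d0; case: (hd t td); exists (t `^ (- 1)).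
have c1 : \forall t \near 0^'+, 1 <= c t by apply: filterS nearP => t [[]].
have c0 : \forall t \near 0^'+, 0 < c t.
  by apply: filterS c1 => t; apply: lt_le_trans.
have [r cr] := has_order_exists omin pbdd dfc c0.
have r0 : r = 0.
  apply/eqP; rewrite eq_le !leNgt; apply/andP; split; apply/negP => r0.
    have e0 : 0 < r / 2 by lra.
    have h : \forall t \near (0 : R)^'+, False.
      apply: filterS3 (near_ln_lt0 R) c1 (cr _ e0) => t lt /ln_ge0 ct /andP[_ h].
      have : r / 2 * ln t < 0 by rewrite pmulr_rlt0.
      lra.
    by have [] := near_right_ex h.
  have e0 : 0 < - r / 2 by lra.
  have e4 : 0 < - r / 4 by lra.
  have [d d0 hd] := (near_rightP _ _).1 (filterI (filterI nearP c1)
    (filterI (cr _ e0) (near_ln_lt (4 * ln 2 / r)))).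
  have [t td [t1 [x tx]]] := freq _ _ e4 d0.
  have [[[_ nc] ct1] [/andP[h1 _] h2]] := hd t td.
  have t0 : 0 < t by case/andP: td.
  have lec : c t / 2 <= t `^ (- (- r / 4)).
    rewrite leNgt; apply/negP => lc; apply: nc.
    have cc : 1 <= c t / 2 by apply: le_trans t1 (ltW lc).
    by split=> //; exists x; apply: controlled_le tx => //; apply: ltW.
  have ct0 : 0 < c t by apply: lt_le_trans ct1.
  move: lec; rewrite -ler_ln ?posrE ?powR_gt0 ?divr_gt0 // ln_powR ln_div ?posrE //.
  move: h2; rewrite ltr_ndivlMr // => h2; lra.
rewrite {}r0 in cr.
have [C C0 hC] := order0_bounded omin pbdd dfc c0 cr.
exists (1 + C); first by rewrite lerDl ltW.
apply: filterS2 nearP hC => t [[ct1 [x tx]] _] cC.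
by exists x; apply: controlled_le tx => //; lra.
Qed.

(** The existence of a controlled point is one formula in [t], true near [0^'+],
    hence true in the Hardy field of the germ of the identity; its witnesses
    there are the wanted germs. *)
Lemma controlled_germs K :
  (\forall t \near 0^'+, exists x, controlled t K x) ->
  exists h : 'I_n -> hardy E,
    \forall t \near 0^'+, controlled t K (fun i => hrepr (h i) t).
Proof.
move=> hK.
have [p pE] : defpred E (fun e : 'I_(n + 1) -> R =>
    controlled (e (rshift n ord0)) K (fun i => e (lshift 1 i))).
  apply: defpred_and; first exact: (defpred_ren (lshift 1) (defpred_sat E phi)).
  apply: defpred_forall_ord => i.
  have dqi : dfun E (q i) by apply: dq.
  by definable.
have did : dfun E id by definable.
pose tau (_ : 'I_1) : hardy E := germ (definable_fun_pos_dfun did).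
have htau : \forall t \near 0^'+, forall i, hrepr (tau i) t = t.
  by apply: near_forall_ord => i; exact: hrepr_germ.
have catl (T : Type) (a : 'I_n -> T) (b : 'I_1 -> T) i : env_cat a b (lshift 1 i) = a i.
  by rewrite /env_cat (unsplitK (inl _)).
have catr (T : Type) (a : 'I_n -> T) (b : 'I_1 -> T) i : env_cat a b (rshift n i) = b i.
  by rewrite /env_cat (unsplitK (inr _)).
have : sat (hardy_structure E) (@hcst R L E) (Exn p) tau.
  apply/(sat_hardy omin); apply: filterS2 htau hK => t ht [x tx].
  apply/sat_Exn; exists x; apply/pE; rewrite catr ht.
  by under [X in controlled _ _ X]eq_fun do rewrite catl.
move=> /sat_Exn[h /(sat_hardy omin) hp]; exists h.
apply: filterS2 htau hp => t ht /pE; rewrite catr ht.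
by under [X in controlled _ _ X]eq_fun do rewrite catl.
Qed.
End Lift.
End Lifting.

Theorem theorem4p2 (R : realType) (L : language) (E : structure L R)
    (n : nat) (V : set 'rV[R]_n) (phi : formula (sum_lang oring_lang L) R n) :
  o_minimal (expansion E) ->
  polynomially_bounded (expansion E) ->
  V `<=` [set x : 'rV[R]_n | forall i : 'I_n, 0 < x ord0 i] ->
  V = defset (expansion E) phi ->
  log_limit_set V `&`
    [set y : 'rV[R]_n | forall i : 'I_n, field_of_exponents (expansion E) (y ord0 i)]
  = Log_hardy (hardy_ext E phi).
Proof.
move=> omin pbdd Vpos VE.
have satV (e : 'I_n -> R) : sat (expansion E) id phi e -> V (\row_i e i).
  by rewrite VE => /defset_row.
have satpos (e : 'I_n -> R) : sat (expansion E) id phi e -> forall i, 0 < e i.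
  by move=> /satV/Vpos /= h i; have := h i; rewrite mxE.
apply/seteqP; split=> [y [yV yL]|_ [h hphi <-]]; last first.
  have hsat := (sat_hardy omin phi h).1 hphi.
  have h0 i : \forall t \near 0^'+, 0 < hrepr (h i) t.
    by apply: filterS hsat => t /satpos; apply.
  have hasy i := germ_asymptotics omin pbdd (h0 i).
  have hord i : has_order (hrepr (h i)) (hval (h i)).
    have [r [c [hr _ _]]] := hasy i.
    by rewrite (hval_has_order omin pbdd (h0 i) hr).
  split=> [|i /=].
    by apply: germs_in_limit hord; apply: filterS hsat => t; apply: satV.
  rewrite mxE; have [r [c [hr c0 hc]]] := hasy i.
  rewrite (hval_has_order omin pbdd (h0 i) hr).
  apply: (@cvg_exponent _ _ _ (hrep (h i)) _ c); rewrite ?gt_eqF //.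
    exact: dfun_hrep.
  by apply: cvg_trans hc; apply: near_eq_cvg; apply: filterS (near_hrep (h i)) => t ->.
have /(_ _)/cid2-/all_sig2[q dq hq] := fun i => exponent_power omin (yL i).
have hq' := near_forall_ord hq.
have [K K1 hK] : exists2 K : R, 1 <= K &
    \forall t \near 0^'+, exists x, controlled E phi q t K x.
  apply: controlled_uniformly => // eps d e0 d0.
  have [d' d'0 hd'] := (near_rightP _ _).1 hq'.
  have m0 : 0 < Num.min d d' by rewrite lt_min d0.
  have [x [t [Vx /andP[t0 tm] t1 hx]]] := limit_frequently yV e0 m0.
  move: tm; rewrite lt_min => /andP[td td'].
  have lt : ln t < 0 by rewrite ln_lt0 // t0.
  have lte : eps * ln t < 0 by rewrite pmulr_rlt0.
  exists t; first by rewrite t0.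
  split.
    by rewrite -(powRr0 t) -ler_ln ?posrE ?powR_gt0 // !ln_powR mul0r; lra.
  exists (x ord0); split=> [|i]; first by move: Vx; rewrite VE.
  have xi : 0 < x ord0 i by apply: Vpos.
  have -> : q i t = t `^ y ord0 i by apply: hd'; rewrite t0.
  have qt := powR_gt0 (y ord0 i) t0; have ct := powR_gt0 (- eps) t0.
  have /andP[h1 h2] := hx i.
  rewrite -ler_ln ?posrE ?mulr_gt0 // -[1 <= _]ler_ln ?posrE ?mulr_gt0 //.
  rewrite ln1 !lnM ?posrE ?mulr_gt0 // !ln_powR; split; lra.
have [h hh] := controlled_germs omin dq hK.
exists h.
  by apply/(sat_hardy omin); apply: filterS hh => t [].
apply/rowP => i; rewrite mxE.
have h0 : \forall t \near 0^'+, 0 < hrepr (h i) t.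
  by apply: filterS hh => t [/satpos].
have K0 : 0 < K by apply: lt_le_trans K1.
have Ki0 : 0 < K^-1 by rewrite invr_gt0.
have hord : has_order (hrepr (h i)) (- y ord0 i).
  apply: (has_order_bounded Ki0 (b := K)).
  apply: filterS2 hq' hh => t qt [_ /(_ i)]; rewrite qt powRN invrK => -[-> h1].
  by rewrite andbT -[K^-1]mulr1 ler_pdivrMl.
by rewrite (hval_has_order omin pbdd h0 hord) opprK.
Qed.
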